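(* Let $m\in\mathbb{N}$ and let $V\in H_{+}^{-m}$ be a 1-periodic complex-valued distribution. Then the operators $S_{+}(V)$ and $S_{-}(V)$ on $L_2(0,1)$ are local: if $u\in\mathrm{Dom}(S_{\pm})$ and $u|_{(a,b)}=0$ for an interval $(a,b)\subset[0,1]$, then $(S_{\pm}(V)u)|_{(a,b)}=0$.
   Context: For $s\in\mathbb{R}$, $H_{+}^{s}$ is the space of formal series $f=\sum_{k\in\mathbb{Z}}\widehat f(2k)e^{i2k\pi x}$ with $\|f\|_{H_+^s}^2=\sum_k\langle 2k\rangle^{2s}|\widehat f(2k)|^2<\infty$, and $H_{-}^{s}$ is the space of formal series $f=\sum_{k}\widehat f(2k+1)e^{i(2k+1)\pi x}$ with $\|f\|_{H_-^s}^2=\sum_k\langle 2k+1\rangle^{2s}|\widehat f(2k+1)|^2<\infty$, where $\langle k\rangle=1+|k|$; $H_\pm^0=L_2(0,1)$. $\langle\cdot,\cdot\rangle_{\pm}$ is the pairing between $H_\pm^{s}$ and $H_\pm^{-s}$ extending the $L_2(0,1)$ inner product. $D_{\pm}=-i\,d/dx$ on $H_\pm^1$, $D_\pm^{2m}=|D_\pm|^{2m}$ (multiplication by $(n\pi)^{2m}$ on the mode $e^{in\pi x}$). For $u\in H_\pm^{m}$, $V(x)u=\sum_n\big(\sum_j\widehat V(n-j)\widehat u(j)\big)e^{in\pi x}\in H_\pm^{-m}$. $S_{\pm}(V)=D_{\pm}^{2m}\dotplus V$ is the $m$-sectorial operator on $L_2(0,1)$ associated with the closed sectorial form $t_\pm[u,v]=\langle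 D_{\pm}^{2m}u,v\rangle_{\pm}+\langle V(x)u,v\rangle_{\pm}$, $\mathrm{Dom}(t_\pm)=H_\pm^m$; explicitly $\mathrm{Dom}(S_{\pm})=\{u\in H_{\pm}^{m}\mid D_{\pm}^{2m}u+V(x)u\in L_{2}(0,1)\}$ and $S_\pm(V)u=D_{\pm}^{2m}u+V(x)u$. *)

(* Defs.v *)
From mathcomp Require Import all_boot all_order all_algebra.
From mathcomp Require Import all_classical all_reals all_analysis.
From mathcomp Require Export complex.
Set Implicit Arguments. Unset Strict Implicit. Unset Printing Implicit Defensive.
Import Order.TTheory GRing.Theory Num.Theory.
Import numFieldNormedType.Exports.
Local Open Scope ring_scope.
Local Open Scope classical_set_scope.
Local Open Scope complex_scope.

(* The two families of spaces: [pl] <-> H_+ (even modes e^{i 2k pi x}),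
   [mi] <-> H_- (odd modes e^{i (2k+1) pi x}). *)
Variant pm := pl | mi.

Definition par (s : pm) : int := if s is mi then 1 else 0.

(* The k-th admissible frequency: n = 2k (for H_+) or n = 2k+1 (for H_-).
   Elements of H_pm^s are coded by their coefficient families c : int -> C,
   c k = \hat f (freq s k). *)
Definition freq (s : pm) (k : int) : int := 2 * k + par s.

Section Defs.
Context (R : realType).
Local Notation C := R[i].

Definition cabs2 (z : C) : R := (complex.Re z) ^+ 2 + (complex.Im z) ^+ 2.

Definition jbr (n : int) : R := 1 + (`|n|%R)%:~R.

(* c (coding f = sum_k c k e^{i freq s k pi x}) belongs to H_s^r :
   sum_k <freq s k>^{2r} |c k|^2 < oo *)
Definition inH (s : pm) (r : int) (c : int -> C) : Prop :=
  summable [set: int] (fun k => ((jbr (freq s k)) ^ (2 * r) * cabs2 (c k))%:E).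

Definition psum (a : int -> C) (N : nat) : C :=
  \sum_(0 <= i < (2 * N).+1) a (i%:Z - N%:Z).

Definition re_psum (a : int -> C) : R^nat := fun N => complex.Re (psum a N).
Definition im_psum (a : int -> C) : R^nat := fun N => complex.Im (psum a N).

Definition Csum (a : int -> C) : C :=
  (limn (re_psum a)) +i* (limn (im_psum a)).

(* coefficients of V(x)u : (V u)^(n) = sum_j V^(n - j) u^(j).
   V is in H_+ (V k = \hat V (2k)); u in H_s (u l = \hat u (freq s l)),
   and freq s k - freq s l = 2 (k - l). *)
Definition mulV (s : pm) (V u : int -> C) (k : int) : C :=
  Csum (fun l => V (k - l) * u l).

(* coefficients of D^{2m} u + V(x) u : (n pi)^{2m} \hat u(n) + (V u)^(n) *)
Definition Scoef (s : pm) (m : nat) (V u : int -> C) (k : int) : C :=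
  ((((freq s k)%:~R * pi) ^+ (2 * m))%:C) * u k + mulV s V u k.

Definition cexp (t : R) : C := cos t +i* sin t.

Definition I01 : set R := `]0, 1[%classic.

Definition fcoef (s : pm) (f : R -> C) (k : int) : C :=
  (Rintegral (@lebesgue_measure R) I01
     (fun x => complex.Re (f x * cexp (- ((freq s k)%:~R * pi * x)))))
  +i*
  (Rintegral (@lebesgue_measure R) I01
     (fun x => complex.Im (f x * cexp (- ((freq s k)%:~R * pi * x))))).

Definition inL2 (f : R -> C) : Prop :=
  measurable_fun I01 (fun x => complex.Re (f x)) /\
  measurable_fun I01 (fun x => complex.Im (f x)) /\
  (\int[@lebesgue_measure R]_(x in I01) ((cabs2 (f x))%:E) < +oo)%E.

Definition represents (s : pm) (f : R -> C) (c : int -> C) : Prop :=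
  inL2 f /\ forall k, fcoef s f k = c k.

End Defs.

(* Main.v *)
(* Test the equation against a bump [phi] supported in [(a, b)]. Writing [c k] for its
   Fourier coefficients and [w] for those of [S u],
   [int g phi = sum_k conj (c k) w k] splits as [int f (D^2m phi) + sum_j V_j (sum_k u_(k-j)
   conj (c k))]; the first term vanishes, and so does every inner sum of the second, which is
   a Fourier coefficient of [f phi = 0]. The interchange of summations is a
   truncation of [V]: since [<k - l> <= <k> <l>], the error is at most
   [<k>^m |u|_m |tail of V|_-m], which is summable against the rapidly decreasing [c].
   Taking [phi (x) = ((x - c) (x - d))^n] on [[c, d]] with [n] even gives enough decay
   by integration by parts; its Fourier series converges to it by Cesaro
   summation of the Dirichlet kernel, and shrinking [[c, d]] to a Lebesgue point of [g]
   shows that [g] vanishes there. *)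

(* The double series over j and k runs through limits of symmetric windows taken in two orders; with
   V cut to finitely many modes the exchange becomes finite, and what remains must be small
   uniformly in the window. Cauchy-Schwarz is replaced there by a weighted Young inequality with a
   free parameter e, so that sums are estimated term by term. The price is a bound of the form tau /
   e + e <k>^(2m) instead of a product, so the coefficients of the bump have to be summable against
   <k>^(2m). This takes 2m + 2 integrations by parts, hence a zero of order above 2m + 2 at both
   ends, and 2m + 4 is the first even exponent. The pairing with g is obtained without completeness
   of the exponentials: the partial sums of the bump are inserted under the integral. No density of
   test functions is used either. On an interval of radius r the bump is nonnegative, at most
   r^(2n), and at least (3/4)^n r^(2n) on the middle half, so one bump per interval controls |g(x)|
   by a mean oscillation, with a constant independent of r. *)
Require Import Defs.
From mathcomp Require Import all_boot all_order all_algebra.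
From mathcomp Require Import all_classical all_reals all_analysis.
From mathcomp Require Import complex.
From mathcomp Require Import measurable_realfun ring lra zify.
Import Order.TTheory GRing.Theory Num.Theory.
Import numFieldNormedType.Exports.
Set Implicit Arguments.
Unset Strict Implicit.
Unset Printing Implicit Defensive.
Local Open Scope ring_scope.
Local Open Scope classical_set_scope.
Local Open Scope complex_scope.

(** * Complex numbers and symmetric sums *)

Section complex_facts.
Context {R : realType}.
Local Notation C := R[i].
Local Notation nc := (@Normc.normc R).
Implicit Types (x y z : C) (t : R).

Lemma Re_addc x y : complex.Re (x + y) = complex.Re x + complex.Re y.
Proof. by case: x y => [a b] [c d]. Qed.

Lemma Im_addc x y : complex.Im (x + y) = complex.Im x + complex.Im y.
Proof. by case: x y => [a b] [c d]. Qed.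

Lemma Re_oppc x : complex.Re (- x) = - complex.Re x.
Proof. by case: x. Qed.

Lemma Im_oppc x : complex.Im (- x) = - complex.Im x.
Proof. by case: x. Qed.

Lemma Re_mulc x y : complex.Re (x * y) =
  complex.Re x * complex.Re y - complex.Im x * complex.Im y.
Proof. by case: x y => [a b] [c d]. Qed.

Lemma Im_mulc x y : complex.Im (x * y) =
  complex.Re x * complex.Im y + complex.Im x * complex.Re y.
Proof. by case: x y => [a b] [c d]. Qed.

Lemma Re_conjc x : complex.Re (conjc x) = complex.Re x.
Proof. by case: x. Qed.

Lemma Im_conjc x : complex.Im (conjc x) = - complex.Im x.
Proof. by case: x. Qed.

Lemma Re_sum (I : Type) (r : seq I) (F : I -> C) :
  complex.Re (\sum_(i <- r) F i) = \sum_(i <- r) complex.Re (F i).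
Proof. exact: (big_morph _ Re_addc). Qed.

Lemma Im_sum (I : Type) (r : seq I) (F : I -> C) :
  complex.Im (\sum_(i <- r) F i) = \sum_(i <- r) complex.Im (F i).
Proof. exact: (big_morph _ Im_addc). Qed.

Lemma complex_eqP x y :
  complex.Re x = complex.Re y -> complex.Im x = complex.Im y -> x = y.
Proof. by case: x y => [a b] [c d] /= -> ->. Qed.

Lemma normc_ge0 x : 0 <= nc x.
Proof. by case: x => a b; exact: sqrtr_ge0. Qed.

Lemma sqr_normc_cabs2 x : nc x ^+ 2 = cabs2 x.
Proof. by case: x => a b; rewrite /= sqr_sqrtr// addr_ge0// sqr_ge0. Qed.

Lemma normc_sum (I : Type) (r : seq I) (F : I -> C) :
  nc (\sum_(i <- r) F i) <= \sum_(i <- r) nc (F i).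
Proof.
elim: r => [|i r IH]; first by rewrite !big_nil Normc.normc0.
by rewrite !big_cons (le_trans (le_normcD _ _))// lerD2l.
Qed.

Lemma normc_conjc x : nc (conjc x) = nc x.
Proof. by case: x => a b /=; rewrite sqrrN. Qed.

Lemma Re_le_normc x : `|complex.Re x| <= nc x.
Proof.
by case: x => a b /=; rewrite -sqrtr_sqr ler_wsqrtr// lerDl sqr_ge0.
Qed.

Lemma Im_le_normc x : `|complex.Im x| <= nc x.
Proof.
by case: x => a b /=; rewrite -sqrtr_sqr ler_wsqrtr// lerDr sqr_ge0.
Qed.

Lemma normc_le_ReIm x : nc x <= `|complex.Re x| + `|complex.Im x|.
Proof.
case: x => a b /=; rewrite -[leRHS]ger0_norm ?addr_ge0//.
rewrite -sqrtr_sqr ler_wsqrtr// sqrrD !real_normK ?num_real//.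
by rewrite lerD2r lerDl mulrn_wge0// mulr_ge0.
Qed.

Lemma normc_real t : nc t%:C = `|t|.
Proof. by rewrite /= expr0n addr0 sqrtr_sqr. Qed.

Lemma cexpD t u : cexp (t + u) = cexp t * cexp u :> C.
Proof.
by apply: complex_eqP; rewrite (Re_mulc, Im_mulc) /= (cosD, sinD)// addrC mulrC.
Qed.

Lemma cexp0 : cexp 0 = 1 :> C.
Proof. by rewrite /cexp cos0 sin0. Qed.

Lemma normc_cexp t : nc (cexp t) = 1.
Proof. by rewrite /= cos2Dsin2 sqrtr1. Qed.

Lemma conjc_cexp t : conjc (cexp t) = cexp (- t) :> C.
Proof. by rewrite /cexp /= cosN sinN. Qed.

End complex_facts.

Section complex_convergence.
Context {R : realType}.
Local Notation C := R[i].
Local Notation nc := (@Normc.normc R).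
Implicit Types (a b : nat -> C) (l : C).

Definition ccvg a l :=
  complex.Re (a n) @[n --> \oo] --> complex.Re l /\
  complex.Im (a n) @[n --> \oo] --> complex.Im l.

Lemma ccvg_cst l : ccvg (fun=> l) l.
Proof. by split; exact: cvg_cst. Qed.

Lemma ccvgD a b k l : ccvg a k -> ccvg b l -> ccvg (fun n => a n + b n) (k + l).
Proof.
move=> [ak1 ak2] [bl1 bl2]; split.
  by under eq_fun do rewrite Re_addc; rewrite Re_addc; exact: cvgD.
by under eq_fun do rewrite Im_addc; rewrite Im_addc; exact: cvgD.
Qed.

Lemma ccvgM a b k l : ccvg a k -> ccvg b l -> ccvg (fun n => a n * b n) (k * l).
Proof.
move=> [ak1 ak2] [bl1 bl2]; split.
  by under eq_fun do rewrite Re_mulc; rewrite Re_mulc; apply: cvgB; exact: cvgM.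
by under eq_fun do rewrite Im_mulc; rewrite Im_mulc; apply: cvgD; exact: cvgM.
Qed.

Lemma ccvg_conjc a k : ccvg a k -> ccvg (fun n => conjc (a n)) (conjc k).
Proof.
move=> [ak1 ak2]; split.
  by under eq_fun do rewrite Re_conjc; rewrite Re_conjc.
by under eq_fun do rewrite Im_conjc; rewrite Im_conjc; exact: cvgN.
Qed.

Lemma ccvg_sum (I : Type) (r : seq I) (F : I -> nat -> C) (L : I -> C) :
  (forall i, ccvg (F i) (L i)) ->
  ccvg (fun n => \sum_(i <- r) F i n) (\sum_(i <- r) L i).
Proof.
move=> FL; elim: r => [|i r IH].
  under [X in ccvg X]eq_fun do rewrite big_nil.
  by rewrite big_nil; exact: ccvg_cst.
under [X in ccvg X]eq_fun do rewrite big_cons.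
by rewrite big_cons; exact: ccvgD.
Qed.

Lemma ccvg_unique a k l : ccvg a k -> ccvg a l -> k = l.
Proof.
move=> [ak1 ak2] [al1 al2]; apply: complex_eqP.
  exact: (cvg_unique _ ak1 al1).
exact: (cvg_unique _ ak2 al2).
Qed.

Lemma ccvgP a l : ccvg a l <-> nc (a n - l) @[n --> \oo] --> (0 : R).
Proof.
split=> [[al1 al2]|al].
  apply: (@squeeze_cvgr _ _ _ _ (cst 0) (fun n => `|complex.Re (a n) - complex.Re l|
    + `|complex.Im (a n) - complex.Im l|)).
  - near=> n; rewrite normc_ge0/= (le_trans (normc_le_ReIm _))//.
    by rewrite Re_addc Im_addc Re_oppc Im_oppc.
  - exact: cvg_cst.
  - rewrite -[X in _ --> X](addr0 (0 : R)); apply: cvgD.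
      rewrite -(normr0 R) -(subrr (complex.Re l)).
      by apply: cvg_norm; apply: cvgB => //; exact: cvg_cst.
    rewrite -(normr0 R) -(subrr (complex.Im l)).
    by apply: cvg_norm; apply: cvgB => //; exact: cvg_cst.
split; apply/cvgrPdist_le => e e0; move/cvgrPdist_le : al => /(_ _ e0);
  apply: filterS => n; rewrite sub0r normrN ger0_norm ?normc_ge0// => /(le_trans _);
  apply; rewrite distrC.
  by rewrite -Re_oppc -Re_addc Re_le_normc.
by rewrite -Im_oppc -Im_addc Im_le_normc.
Unshelve. all: by end_near. Qed.

Lemma ccvg_norm a l : ccvg a l -> nc (a n) @[n --> \oo] --> nc l.
Proof.
move=> /ccvgP al; apply/cvgrPdist_le => e e0.
move/cvgrPdist_le : al => /(_ _ e0); apply: filterS => n.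
rewrite sub0r normrN ger0_norm ?normc_ge0// => le; rewrite ler_norml.
have := le_normcD (a n - l) l; rewrite subrK => h1.
have := le_normcD (l - a n) (a n); rewrite subrK -opprB normcN => h2.
lra.
Qed.

End complex_convergence.

(** * Unordered summability and symmetric windows of integers *)

Section finite_sums.
Context {R : realType}.

Lemma ler_sum_uniq_sub (T : eqType) (s1 s2 : seq T) (q : T -> R) :
  uniq s1 -> uniq s2 -> {subset s1 <= s2} -> (forall i, 0 <= q i) ->
  \sum_(i <- s1) q i <= \sum_(i <- s2) q i.
Proof.
move=> u1 u2 s12 q0; rewrite [leRHS](bigID (mem s1))/= -[X in _ <= X + _]big_filter.
rewrite [X in _ <= X + _](perm_big s1)/=; last first.
  apply: uniq_perm => // [|x]; first by rewrite filter_uniq.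
  by rewrite mem_filter andb_idr//; exact: s12.
by rewrite lerDl sumr_ge0.
Qed.

Lemma summable_sum_bound (T : choiceType) (q : T -> R) :
  (forall i, 0 <= q i) -> summable [set: T] (fun i => (q i)%:E) ->
  exists B, forall s, uniq s -> \sum_(i <- s) q i <= B.
Proof.
move=> q0; rewrite summableE => /fineK qfin.
exists (fine (\esum_(x in [set: T]) `|(q x)%:E|)%E) => s us.
rewrite -lee_fin qfin; apply: esum_ge; exists [set` s].
  by split => //; exact: finite_seq.
rewrite -fsbig_seq// -sumEFin; apply: lee_sum => i _.
by rewrite gee0_abs ?lee_fin.
Qed.

(** Take a finite list whose sum is within [e] of the supremum of all finite sums. A list disjoint
    from it can be appended without exceeding the supremum, so its own sum is at most [e]. *)
Lemma summable_sum_tail (T : choiceType) (q : T -> R) :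
  (forall i, 0 <= q i) -> summable [set: T] (fun i => (q i)%:E) ->
  forall e, 0 < e -> exists2 s0 : seq T, uniq s0 & forall s, uniq s ->
    (forall i, i \in s -> i \notin s0) -> \sum_(i <- s) q i <= e.
Proof.
move=> q0 /(summable_sum_bound q0)[B Bub] e e0.
pose E : set R := [set x | exists2 s : seq T, uniq s & x = \sum_(i <- s) q i].
have supE : has_sup E.
  split; first by exists 0; exists [::] => //; rewrite big_nil.
  by exists B => x [s us ->]; exact: Bub.
have [_ [s0 us0 ->] hs0] := sup_adherent e0 supE.
exists s0 => // s us ss0.
have : \sum_(i <- s0 ++ s) q i <= sup E.
  apply: sup_upper_bound => //; exists (s0 ++ s) => //.
  rewrite cat_uniq us0 us andbT/=; apply/hasPn => i /ss0.
  by [].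
rewrite big_cat/=; lra.
Qed.

(** Keeping the window as a duplicate-free list of integers lets sums be filtered, shifted and
    compared as permutations. *)
Definition rng (N : nat) : seq int :=
  [seq i%:Z - N%:Z | i <- index_iota 0 (2 * N).+1].
Arguments rng : simpl never.

Lemma uniq_rng N : uniq (rng N).
Proof. by rewrite map_inj_uniq ?iota_uniq// => i j /addIr[]. Qed.

Lemma mem_rng N (k : int) : (k \in rng N) = (`|k| <= N)%N.
Proof.
apply/mapP/idP => [[j]|kN]; first by rewrite mem_index_iota => ? ->; lia.
by exists (absz (k + N%:Z)); [rewrite mem_index_iota; lia|lia].
Qed.

Lemma psumE (a : int -> R[i]) N : psum a N = \sum_(k <- rng N) a k.
Proof. by rewrite /psum /rng big_map. Qed.

Lemma rng_recr (V : nmodType) (a : int -> V) N :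
  \sum_(k <- rng N.+1) a k =
  \sum_(k <- rng N) a k + (a N.+1%:Z + a (- N.+1%:Z)).
Proof.
rewrite (perm_big (N.+1%:Z :: - N.+1%:Z :: rng N)); last first.
  apply: uniq_perm => [||k]; first exact: uniq_rng.
    by rewrite 2!cons_uniq uniq_rng andbT in_cons !mem_rng; lia.
  by rewrite mem_rng 2!in_cons mem_rng; lia.
by rewrite 2!big_cons /= addrA addrC.
Qed.

Lemma cvg_rng_ge0 (q : int -> R) B : (forall k, 0 <= q k) ->
  (forall N, \sum_(k <- rng N) q k <= B) ->
  cvgn (fun N => \sum_(k <- rng N) q k).
Proof.
move=> q0 qB; apply: nondecreasing_is_cvgn.
  apply/nondecreasing_seqP => n; apply: ler_sum_uniq_sub => //; rewrite ?uniq_rng//.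
  by move=> k; rewrite !mem_rng; lia.
by exists B => _ [N _ <-].
Qed.

(** Write q as (|q| + q) - |q|: both parts are nonnegative with bounded window sums, hence have
    monotone convergent sums. *)
Lemma cvg_rng_norm (q : int -> R) B :
  (forall N, \sum_(k <- rng N) `|q k| <= B) ->
  cvgn (fun N => \sum_(k <- rng N) q k).
Proof.
move=> qB.
have -> : (fun N => \sum_(k <- rng N) q k) =
  (fun N => \sum_(k <- rng N) (`|q k| + q k)) \- (fun N => \sum_(k <- rng N) `|q k|).
  by apply/funext => N /=; rewrite big_split/= addrAC subrr add0r.
apply: is_cvgB; last exact: cvg_rng_ge0 qB.
apply: (@cvg_rng_ge0 _ (B + B)).
  by move=> k; have := ler_norm (- q k); rewrite normrN; lra.
move=> N; rewrite big_split/= lerD//; apply: le_trans (qB N).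
by apply: ler_sum => k _; exact: ler_norm.
Qed.

(** [Csum] is built from [limn], which is meaningful only along a convergent sequence; absolute
    summability makes it a true limit of the symmetric sums. *)
Lemma ccvg_psum (a : int -> R[i]) B :
  (forall N, \sum_(k <- rng N) Normc.normc (a k) <= B) -> ccvg (psum a) (Csum a).
Proof.
move=> aB.
have reE : re_psum a = fun N => \sum_(k <- rng N) complex.Re (a k).
  by apply/funext => N; rewrite /re_psum psumE Re_sum.
have imE : im_psum a = fun N => \sum_(k <- rng N) complex.Im (a k).
  by apply/funext => N; rewrite /im_psum psumE Im_sum.
have cre : cvgn (re_psum a).
  rewrite reE; apply: (@cvg_rng_norm _ B) => N; apply: le_trans (aB N).
  by apply: ler_sum => k _; exact: Re_le_normc.
have cim : cvgn (im_psum a).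
  rewrite imE; apply: (@cvg_rng_norm _ B) => N; apply: le_trans (aB N).
  by apply: ler_sum => k _; exact: Im_le_normc.
by split; [exact: cre|exact: cim].
Qed.

End finite_sums.

(** * Integrals of complex functions on the unit interval *)

Section complex_integral.
Context {R : realType}.
Local Notation C := R[i].
Local Notation nc := (@Normc.normc R).
Local Notation mu := (@lebesgue_measure R).
Local Notation I := (@I01 R).
Implicit Types (F G : R -> C) (z : C).

Definition cmeas F := measurable_fun I (fun x => complex.Re (F x)) /\
  measurable_fun I (fun x => complex.Im (F x)).

Definition cintegrable F :=
  mu.-integrable I (EFin \o (fun x => complex.Re (F x))) /\
  mu.-integrable I (EFin \o (fun x => complex.Im (F x))).

Definition Cint F : C := (Rintegral mu I (fun x => complex.Re (F x)))
  +i* (Rintegral mu I (fun x => complex.Im (F x))).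

Lemma measurable_I01 : measurable I.
Proof. exact: measurable_itv. Qed.
Local Hint Resolve measurable_I01 : core.

Lemma lebesgue_measure_I01 : mu I = 1%E.
Proof. by rewrite lebesgue_measure_itv/= lte01 oppr0 adde0. Qed.

Lemma integrable_cst_I01 (r : R) : mu.-integrable I (EFin \o cst r).
Proof.
apply/integrableP; split; first exact/measurable_EFinP/measurable_cst.
under eq_integral do rewrite /=.
by rewrite integral_cst//= lebesgue_measure_I01 mule1 ltry.
Qed.

Lemma cmeas_cst z : cmeas (fun=> z).
Proof. by split; exact: measurable_cst. Qed.

Lemma cmeasD F G : cmeas F -> cmeas G -> cmeas (fun x => F x + G x).
Proof.
move=> [f1 f2] [g1 g2]; split.
  by under eq_fun do rewrite Re_addc; exact: measurable_funD.
by under eq_fun do rewrite Im_addc; exact: measurable_funD.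
Qed.

Lemma cmeasM F G : cmeas F -> cmeas G -> cmeas (fun x => F x * G x).
Proof.
move=> [f1 f2] [g1 g2]; split.
  by under eq_fun do rewrite Re_mulc; apply: measurable_funB; exact: measurable_funM.
by under eq_fun do rewrite Im_mulc; apply: measurable_funD; exact: measurable_funM.
Qed.

Lemma cmeas_conjc F : cmeas F -> cmeas (fun x => conjc (F x)).
Proof.
move=> [f1 f2]; split.
  by under eq_fun do rewrite Re_conjc.
by under eq_fun do rewrite Im_conjc; exact: measurableT_comp.
Qed.

Lemma cmeas_sum (J : Type) (r : seq J) (F : J -> R -> C) :
  (forall i, cmeas (F i)) -> cmeas (fun x => \sum_(i <- r) F i x).
Proof.
move=> mF; elim: r => [|i r IH].
  by under [X in cmeas X]eq_fun do rewrite big_nil; exact: cmeas_cst.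
by under [X in cmeas X]eq_fun do rewrite big_cons; exact: cmeasD.
Qed.

Lemma cmeas_cexp (h : R -> R) : continuous h -> cmeas (fun x => cexp (h x)).
Proof.
move=> ch; split; apply: measurable_funTS; apply: continuous_measurable_fun => x /=;
  apply: continuous_comp; [exact: ch|exact: continuous_cos|exact: ch|exact: continuous_sin].
Qed.

Lemma cmeas_real (h : R -> R) : measurable_fun I h -> cmeas (fun x => (h x)%:C).
Proof. by move=> mh; split => //=; exact: measurable_cst. Qed.

Lemma cintegrable_cmeas F : cintegrable F -> cmeas F.
Proof.
by move=> [/measurable_int f1 /measurable_int f2]; split; exact/measurable_EFinP.
Qed.

Lemma cintegrable_dominated F (g : R -> R) : cmeas F ->
  mu.-integrable I (EFin \o g) -> (forall x, I x -> nc (F x) <= g x) ->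
  cintegrable F.
Proof.
move=> [f1 f2] ig Fg; split; apply: le_integrable ig => //.
- exact/measurable_EFinP.
- move=> x Ix /=; rewrite lee_fin (le_trans (Re_le_normc _))//.
  by rewrite (le_trans (Fg _ Ix))// ler_norm.
- exact/measurable_EFinP.
- move=> x Ix /=; rewrite lee_fin (le_trans (Im_le_normc _))//.
  by rewrite (le_trans (Fg _ Ix))// ler_norm.
Qed.

(** A majorant of the modulus whose integrability follows from that of the two components. *)
Definition ReIm_norm F x : R := `|complex.Re (F x)| + `|complex.Im (F x)|.

Lemma integrable_ReIm_norm F : cintegrable F ->
  mu.-integrable I (EFin \o ReIm_norm F).
Proof.
move=> [f1 f2].
rewrite (_ : EFin \o _ = (fun x => `|(complex.Re (F x))%:E| + `|(complex.Im (F x))%:E|)%E)//.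
by apply: integrableD => //; exact: integrable_abse.
Qed.

Lemma cintegrableMb F G B : cintegrable F -> cmeas G ->
  (forall x, I x -> nc (G x) <= B) -> cintegrable (fun x => F x * G x).
Proof.
move=> iF mG GB; apply: (@cintegrable_dominated _ (fun x => ReIm_norm F x * B)).
- by apply: cmeasM => //; exact: cintegrable_cmeas.
- rewrite (_ : EFin \o _ = (fun x => (ReIm_norm F x)%:E * B%:E)%E)//.
  apply: integrableZr => //; exact: integrable_ReIm_norm.
- move=> x Ix; rewrite Normc.normcM ler_pM ?normc_ge0//; last exact: GB.
  exact: normc_le_ReIm.
Qed.

Lemma cintegrableZ z F : cintegrable F -> cintegrable (fun x => z * F x).
Proof.
move=> iF; rewrite (_ : (fun x => _) = fun x => F x * z); last first.
  by apply/funext => x; rewrite mulrC.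
exact: (cintegrableMb iF (cmeas_cst z) (fun _ _ => lexx _)).
Qed.

Lemma cintegrable_bounded F B : cmeas F -> (forall x, I x -> nc (F x) <= B) ->
  cintegrable F.
Proof.
move=> mF FB; apply: (@cintegrable_dominated _ (cst B)) => //.
exact: integrable_cst_I01.
Qed.

Lemma cintegrableD F G : cintegrable F -> cintegrable G ->
  cintegrable (fun x => F x + G x).
Proof.
move=> [f1 f2] [g1 g2]; split.
  by apply: eq_integrable (integrableD _ f1 g1) => // x _ /=; rewrite Re_addc.
by apply: eq_integrable (integrableD _ f2 g2) => // x _ /=; rewrite Im_addc.
Qed.

Lemma eq_Cint F G : (forall x, I x -> F x = G x) -> Cint F = Cint G.
Proof.
move=> FG; congr (_ +i* _); apply: eq_Rintegral => x; rewrite inE => Ix;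
  by rewrite FG.
Qed.

Lemma CintD F G : cintegrable F -> cintegrable G ->
  Cint (fun x => F x + G x) = Cint F + Cint G.
Proof.
move=> [f1 f2] [g1 g2]; apply: complex_eqP; rewrite (Re_addc, Im_addc) /= -RintegralD//.
  by apply: eq_Rintegral => x _; rewrite Re_addc.
by apply: eq_Rintegral => x _; rewrite Im_addc.
Qed.

Lemma integrableZ_real (r : R) (h : R -> R) : mu.-integrable I (EFin \o h) ->
  mu.-integrable I (EFin \o (fun x => r * h x)).
Proof. by move=> ih; apply: eq_integrable (integrableZl _ r ih) => // x _. Qed.

Lemma CintZ z F : cintegrable F -> Cint (fun x => z * F x) = z * Cint F.
Proof.
move=> [f1 f2]; apply: complex_eqP; rewrite (Re_mulc, Im_mulc) /=.
  rewrite -!RintegralZl// -RintegralB//; try exact: integrableZ_real.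
  by apply: eq_Rintegral => x _; rewrite Re_mulc.
rewrite -!RintegralZl// -RintegralD//; try exact: integrableZ_real.
by apply: eq_Rintegral => x _; rewrite Im_mulc.
Qed.

Lemma Cint0 : Cint (fun=> 0) = 0.
Proof. by rewrite /Cint /= Rintegral_cst// mul0r. Qed.

Lemma cintegrable0 : cintegrable (fun=> 0).
Proof. by apply: (@cintegrable_bounded _ 0) => [|x _]; [exact: cmeas_cst|rewrite Normc.normc0]. Qed.

Lemma cintegrable_sum (J : Type) (r : seq J) (F : J -> R -> C) :
  (forall i, cintegrable (F i)) -> cintegrable (fun x => \sum_(i <- r) F i x).
Proof.
move=> iF; elim: r => [|j r IH].
  by under [X in cintegrable X]eq_fun do rewrite big_nil; exact: cintegrable0.
by under [X in cintegrable X]eq_fun do rewrite big_cons; exact: cintegrableD.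
Qed.

Lemma Cint_sum (J : Type) (r : seq J) (F : J -> R -> C) :
  (forall i, cintegrable (F i)) ->
  Cint (fun x => \sum_(i <- r) F i x) = \sum_(i <- r) Cint (F i).
Proof.
move=> iF; elim: r => [|j r IH].
  by under [in LHS]eq_fun do rewrite big_nil; rewrite big_nil Cint0.
under [in LHS]eq_fun do rewrite big_cons.
by rewrite big_cons CintD// ?IH//; exact: cintegrable_sum.
Qed.

Lemma Rintegral_dominated_cvg (f_ : nat -> R -> R) (f g : R -> R) :
  (forall n, measurable_fun I (f_ n)) -> measurable_fun I f ->
  mu.-integrable I (EFin \o g) ->
  (forall n x, I x -> `|f_ n x| <= g x) ->
  (forall x, I x -> f_ n x @[n --> \oo] --> f x) ->
  Rintegral mu I (f_ n) @[n --> \oo] --> Rintegral mu I f.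
Proof.
move=> mf_ mf ig f_g f_f.
have mE n : measurable_fun I (fun x => (f_ n x)%:E) by exact/measurable_EFinP.
have cE : {ae mu, forall x, I x -> (f_ n x)%:E @[n --> \oo] --> (f x)%:E}.
  by apply: aeW => x Ix; apply: cvg_EFin; [exact: nearW|exact: f_f].
have gE : {ae mu, forall x n, I x -> (`|(f_ n x)%:E| <= (g x)%:E)%E}.
  by apply: aeW => x n Ix; rewrite lee_fin; exact: f_g.
have mfE : measurable_fun I (EFin \o f) by exact/measurable_EFinP.
have [/integrable_fin_num fin _ h] := @dominated_convergence _ _ R mu I measurable_I01
  (fun n x => (f_ n x)%:E) (EFin \o f) (EFin \o g) mE mfE cE ig gE.
apply: fine_cvg; rewrite fineK//; last exact: fin.
Qed.

Lemma Cint_dominated_cvg (F_ : nat -> R -> C) F (g : R -> R) :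
  (forall n, cmeas (F_ n)) -> cmeas F -> mu.-integrable I (EFin \o g) ->
  (forall n x, I x -> nc (F_ n x) <= g x) ->
  (forall x, I x -> ccvg (fun n => F_ n x) (F x)) ->
  ccvg (fun n => Cint (F_ n)) (Cint F).
Proof.
move=> mF_ [mF1 mF2] ig F_g F_F; split => /=.
  apply: (@Rintegral_dominated_cvg _ _ g) => //.
  - by move=> n; case: (mF_ n).
  - by move=> n x Ix; rewrite (le_trans (Re_le_normc _))// F_g.
  - by move=> x /F_F[].
apply: (@Rintegral_dominated_cvg _ _ g) => //.
- by move=> n; case: (mF_ n).
- by move=> n x Ix; rewrite (le_trans (Im_le_normc _))// F_g.
- by move=> x /F_F[].
Qed.

(** On a space of measure one, |z| <= 1 + |z|^2 provides an integrable majorant. *)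
Lemma inL2_cintegrable F : inL2 F -> cintegrable F.
Proof.
move=> [m1 [m2 fin]].
have mF : cmeas F by [].
have ic : mu.-integrable I (EFin \o (fun x => cabs2 (F x))).
  apply/integrableP; split.
    by apply/measurable_EFinP; apply: measurable_funD; exact: measurable_funX.
  under eq_integral do rewrite /= ger0_norm ?addr_ge0 ?sqr_ge0//.
  exact: fin.
apply: (@cintegrable_dominated _ (fun x => 1 + cabs2 (F x))) => //.
  exact: (integrableD _ (integrable_cst_I01 1) ic).
move=> x Ix; rewrite -sqr_normc_cabs2.
by have := sqr_ge0 (nc (F x) - 1); have := sqr_ge0 (nc (F x)); rewrite sqrrB; lra.
Qed.

Lemma Cint_ae_eq0 F : cmeas F -> {ae mu, forall x, I x -> F x = 0} -> Cint F = 0.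
Proof.
move=> [m1 m2] F0; apply: complex_eqP => /=; rewrite /Rintegral.
  rewrite (@ae_eq_integral _ _ _ mu _ (cst 0%E)) ?integral0//.
    exact/measurable_EFinP.
  by apply: (filterS (Filter := ae_filter_ringOfSetsType mu)) F0 => x /[apply] /= ->.
rewrite (@ae_eq_integral _ _ _ mu _ (cst 0%E)) ?integral0//.
  exact/measurable_EFinP.
by apply: (filterS (Filter := ae_filter_ringOfSetsType mu)) F0 => x /[apply] /= ->.
Qed.

End complex_integral.

(** * Integration by parts against sines and cosines, and chord estimates on the circle *)

Section trigonometry.
Context {R : realType}.
Local Notation C := R[i].
Local Notation nc := (@Normc.normc R).
Local Notation mu := (@lebesgue_measure R).
Implicit Types (x y t lam c d : R) (Q : {poly R}).

Lemma Rintegral_FTC2 (f F : R -> R) c d : c < d -> continuous f ->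
  (forall x, is_derive x 1 F (f x)) ->
  Rintegral mu `[c, d]%classic f = F d - F c.
Proof.
move=> cd cf dF.
have cF : continuous F.
  by move=> x; apply: differentiable_continuous; apply/derivable1_diffP; case: (dF x).
rewrite /Rintegral (@continuous_FTC2 _ f F)//.
- exact: continuous_subspaceT.
- split.
  + by move=> x _; case: (dF x).
  + by apply: cvg_at_right_filter; exact: cF.
  + by apply: cvg_at_left_filter; exact: cF.
- by move=> x _; rewrite derive1E; case: (dF x).
Qed.

Lemma is_derive_cosM lam x : is_derive x 1 (fun x => cos (lam * x)) (- (lam * sin (lam * x))).
Proof.
have h : is_derive x 1 (fun x => lam * x) lam.
  by apply: is_derive_eq; rewrite /= [LHS]mulr1.
have := @is_derive1_comp _ (@cos R) (fun x => lam * x) x _ _ (is_derive_cos _) h.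
by rewrite mulNr mulrC.
Qed.

Lemma is_derive_sinM lam x : is_derive x 1 (fun x => sin (lam * x)) (lam * cos (lam * x)).
Proof.
have h : is_derive x 1 (fun x => lam * x) lam.
  by apply: is_derive_eq; rewrite /= [LHS]mulr1.
have := @is_derive1_comp _ (@sin R) (fun x => lam * x) x _ _ (is_derive_sin _) h.
by rewrite mulrC.
Qed.

Lemma continuous_cosM lam : continuous (fun x => cos (lam * x)).
Proof.
by move=> x; apply: continuous_comp; [exact: mulrl_continuous|exact: continuous_cos].
Qed.

Lemma continuous_sinM lam : continuous (fun x => sin (lam * x)).
Proof.
by move=> x; apply: continuous_comp; [exact: mulrl_continuous|exact: continuous_sin].
Qed.

(** Integration by parts kept as one integral: the integrand is the derivative of Q cos. *)
Lemma Rintegral_poly_cos Q lam c d : c < d ->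
  Rintegral mu `[c, d]%classic
    (fun x => Q^`().[x] * cos (lam * x) - lam * (Q.[x] * sin (lam * x))) =
  Q.[d] * cos (lam * d) - Q.[c] * cos (lam * c).
Proof.
move=> cd.
have dF x : is_derive x 1 (fun x => Q.[x] * cos (lam * x))
    (Q^`().[x] * cos (lam * x) - lam * (Q.[x] * sin (lam * x))).
  have := is_deriveM (is_derive_poly Q x) (is_derive_cosM lam x).
  by move=> /is_derive_eq; apply; rewrite /GRing.scale/=; ring.
apply: (Rintegral_FTC2 cd _ dF) => x; apply: cvgB.
  by apply: cvgM; [exact: continuous_horner|exact: continuous_cosM].
apply: cvgM; first exact: cvg_cst.
by apply: cvgM; [exact: continuous_horner|exact: continuous_sinM].
Qed.

Lemma Rintegral_poly_sin Q lam c d : c < d ->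
  Rintegral mu `[c, d]%classic
    (fun x => Q^`().[x] * sin (lam * x) + lam * (Q.[x] * cos (lam * x))) =
  Q.[d] * sin (lam * d) - Q.[c] * sin (lam * c).
Proof.
move=> cd.
have dF x : is_derive x 1 (fun x => Q.[x] * sin (lam * x))
    (Q^`().[x] * sin (lam * x) + lam * (Q.[x] * cos (lam * x))).
  have := is_deriveM (is_derive_poly Q x) (is_derive_sinM lam x).
  by move=> /is_derive_eq; apply; rewrite /GRing.scale/=; ring.
apply: (Rintegral_FTC2 cd _ dF) => x; apply: cvgD.
  by apply: cvgM; [exact: continuous_horner|exact: continuous_sinM].
apply: cvgM; first exact: cvg_cst.
by apply: cvgM; [exact: continuous_horner|exact: continuous_cosM].
Qed.

Lemma sin_MVT x : 0 <= x -> exists2 c, 0 <= c <= x & sin x = cos c * x.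
Proof.
move=> x0.
have [|c] := @MVT_segment R sin cos 0 x x0 (fun y _ => is_derive_sin y).
  by apply: continuous_subspaceT => y; exact: continuous_sin.
by rewrite in_itv/= sin0 !subr0; exists c.
Qed.

Lemma normr_sin_le x : `|sin x| <= `|x|.
Proof.
wlog x0 : x / 0 <= x.
  move=> h; have [/h//|/ltW x0] := leP 0 x.
  by have := h (- x); rewrite oppr_ge0 sinN !normrN; apply.
have [c _ ->] := sin_MVT x0.
by rewrite normrM ler_piMl// cos_max.
Qed.

(* From [x cos x <= sin x] and [cos^2 = 1 - sin^2]. *)
Lemma sqr_le_sqr_sin x : 0 <= x <= pi / 2 -> x ^+ 2 <= 5 * sin x ^+ 2.
Proof.
move=> /andP[x0 xpi]; have := @pihalf_lt2 R => pi2.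
have [c /andP[c0 cx] sE] := sin_MVT x0.
have cosx0 : 0 <= cos x by apply: cos_ge0_pihalf; rewrite xpi andbT; lra.
have cosxc : cos x <= cos c.
  move: cx; rewrite le_eqVlt => /predU1P[->//|cx].
  by apply: ltW; rewrite ltr_cos// in_itv/=; apply/andP; split; lra.
have : (x * cos x) ^+ 2 <= sin x ^+ 2.
  by rewrite sE ler_sqr ?nnegrE ?mulr_ge0// ?(le_trans cosx0)// mulrC ler_wpM2r.
have s0 := sqr_ge0 (sin x).
(* Since pi / 2 < 2, x^2 = x^2 cos^2 x + x^2 sin^2 x is at most (1 + 4) sin^2 x, whence the constant
   5. *)
have x4 : x ^+ 2 <= 4 by rewrite (_ : 4 = 2 ^+ 2)// ?ler_sqr ?nnegrE//; lra.
have := ler_wpM2r s0 x4.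
by rewrite exprMn cos2sin2; nra.
Qed.

Lemma sqr_normc_cexp_sub1 t : nc (cexp t - 1) ^+ 2 = 4 * sin (t / 2) ^+ 2.
Proof.
rewrite sqr_normc_cabs2 /cabs2 /= oppr0 addr0.
have {1 2}-> : t = (t / 2) *+ 2 by rewrite -mulr_natr divfK.
rewrite cos_mulr2n sin_mulr2n.
have := cos2Dsin2 (t / 2); set a := cos _; set b := sin _ => ab.
have -> : b ^+ 2 = 1 - a ^+ 2 by rewrite -ab; ring.
rewrite -(mulr_natr (a ^+ 2)) -(mulr_natr (a * b)) exprMn [(a * b) ^+ 2]exprMn.
have -> : b ^+ 2 = 1 - a ^+ 2 by rewrite -ab; ring.
ring.
Qed.

Lemma normc_cexp_sub1_le t : nc (cexp t - 1) <= `|t|.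
Proof.
rewrite -ler_sqr ?nnegrE ?normc_ge0// sqr_normc_cexp_sub1.
have : `|sin (t / 2)| ^+ 2 <= `|t / 2| ^+ 2 by rewrite ler_sqr ?nnegrE// normr_sin_le.
rewrite !real_normK ?num_real//; have -> : (t / 2) ^+ 2 = t ^+ 2 / 4 by field.
lra.
Qed.

(** As x runs over (0, 1), the factor vanishes only at x = x0. The neighbouring zeros, where |x -
    x0| = 1, stay away by the distance [del] of x0 to the endpoints, which is why [K] depends on
    x0. *)
Lemma norm_le_normc_cexp_sub1 x0 : 0 < x0 < 1 -> exists2 K : R, 0 <= K &
  forall x, 0 < x < 1 -> `|x - x0| <= K * nc (cexp (2 * pi * (x0 - x)) - 1).
Proof.
move=> /andP[x00 x01].
have [del [del0 delx0 delx1]] : exists del, [/\ 0 < del, del <= x0 & del <= 1 - x0].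
  exists (Num.min x0 (1 - x0)).
  by rewrite lt_min x00 ge_min lexx ge_min lexx orbT/=; split => //; lra.
exists (2 / del); first by rewrite divr_ge0// ltW.
move=> x /andP[x0' x1'].
have pi2 := @pi_ge2 R.
rewrite -ler_sqr ?nnegrE ?mulr_ge0 ?normc_ge0 ?invr_ge0 ?(ltW del0)//.
rewrite exprMn sqr_normc_cexp_sub1.
have -> : 2 * pi * (x0 - x) / 2 = - (pi * (x - x0)) by field.
rewrite sinN sqrrN.
set y := x - x0.
have sinE : sin (pi * y) ^+ 2 = sin (pi * `|y|) ^+ 2.
  have [y0|y0] := ger0P y; first by [].
  by rewrite mulrN sinN sqrrN.
have ydel : `|y| <= 1 - del by rewrite ler_norml /y; lra.
rewrite sinE.
have y0 : 0 <= `|y| by [].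
suff h : del ^+ 2 * `|y| ^+ 2 <= 5 * sin (pi * `|y|) ^+ 2.
  rewrite exprMn exprVn.
  have -> : 2 ^+ 2 / del ^+ 2 * (4 * sin (pi * `|y|) ^+ 2) =
    (16 * sin (pi * `|y|) ^+ 2) / del ^+ 2 by ring.
  rewrite ler_pdivlMr ?exprn_gt0//; have := sqr_ge0 (sin (pi * `|y|)); lra.
move: `|y| y0 ydel => {sinE}{}y y0 ydel.
(* Up to 1/2 the sine bound applies directly; beyond, it is applied to the reflected point 1 - y,
   which is at least [del]. *)
have [y12|y12] := leP y (1 / 2).
  have := @sqr_le_sqr_sin (pi * y); rewrite mulr_ge0 ?pi_ge0//=.
  rewrite ler_pM2l ?pi_gt0// -[X in _ <= X]mul1r y12 => /(_ isT).
  apply: le_trans; rewrite -exprMn ler_sqr ?nnegrE ?mulr_ge0 ?pi_ge0 ?(ltW del0)//.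
  by rewrite ler_wpM2r//; lra.
have -> : sin (pi * y) = sin (pi * (1 - y)).
  by rewrite mulrBr mulr1 -[in LHS](subrK pi (pi * y)) sinDpi -sinN opprB.
have := @sqr_le_sqr_sin (pi * (1 - y)); rewrite mulr_ge0 ?pi_ge0//=; last lra.
rewrite ler_pM2l ?pi_gt0// (_ : 1 - y <= 2^-1); last lra.
move=> /(_ isT); apply: le_trans.
rewrite -exprMn ler_sqr ?nnegrE ?mulr_ge0 ?pi_ge0 ?(ltW del0)//; last lra.
nra.
Qed.

End trigonometry.

(** * Pointwise Fourier inversion *)

Section dirichlet_kernel.
Context {R : realType}.
Local Notation C := R[i].
Local Notation nc := (@Normc.normc R).
Local Notation mu := (@lebesgue_measure R).
Local Notation I := (@I01 R).

Definition dirichlet (n : nat) (t : R) : C := \sum_(k <- rng n) cexp (k%:~R * t).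

(** The telescoping geometric sum, with the denominator cleared so that it also holds where cexp t =
    1. *)
Lemma dirichletM (n : nat) t :
  (cexp t - 1) * dirichlet n t = cexp (n.+1%:R * t) - cexp (- (n%:R * t)) :> C.
Proof.
rewrite /dirichlet; elim: n => [|n IH].
  by rewrite big_seq1 mul0r oppr0 !mul1r cexp0 mulr1.
rewrite rng_recr mulrDr IH.
have -> : cexp (n.+2%:R * t) = cexp t * cexp (n.+1%:R * t) :> C.
  by rewrite -cexpD -[n.+2%:R]natr1 mulrDl mul1r addrC.
have -> : cexp (- (n%:R * t)) = cexp t * cexp (- (n.+1%:R * t)) :> C.
  by rewrite -cexpD -[n.+1%:R]natr1 mulrDl mul1r opprD addrC subrK.
rewrite mulNr -[n.+1%:Z%:~R]/(n.+1%:R : R).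
ring.
Qed.

(** A second telescoping. The sum is N times the Fejer kernel, whose double pole is cleared by the
    square. *)
Lemma sum_dirichletM (N : nat) t :
  (cexp t - 1) ^+ 2 * (\sum_(0 <= n < N) dirichlet n t) =
  cexp (N.+1%:R * t) - 2 * cexp t + cexp (t - N%:R * t) :> C.
Proof.
elim: N => [|N IH].
  by rewrite big_geq// mulr0 mul0r subr0 mul1r; ring.
rewrite big_nat_recr//= mulrDr IH expr2 -mulrA dirichletM.
have -> : cexp (N.+2%:R * t) = cexp t * cexp (N.+1%:R * t) :> C.
  by rewrite -cexpD -[N.+2%:R]natr1 mulrDl mul1r addrC.
have -> : cexp (t - N%:R * t) = cexp t * cexp (- (N%:R * t)) :> C by rewrite -cexpD.
have -> : t - N.+1%:R * t = - (N%:R * t) by rewrite -[N.+1%:R]natr1 mulrDl mul1r; ring.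
ring.
Qed.

(** Clearing one pole leaves growth of order N. After division by N this is the uniform bound that
    serves for domination. *)
Lemma normc_sum_dirichlet1 (N : nat) t :
  nc (cexp t - 1) * nc (\sum_(0 <= n < N) dirichlet n t) <= 2 * N%:R.
Proof.
rewrite -Normc.normcM mulr_sumr (le_trans (normc_sum _ _))//.
apply: (@le_trans _ _ (\sum_(0 <= n < N) 2)); last first.
  by rewrite sumr_const_nat subn0 mulr_natr.
apply: ler_sum => n _; rewrite dirichletM (le_trans (le_normcD _ _))//.
by rewrite normcN !normc_cexp.
Qed.

(** Clearing both poles leaves a constant. After division by N this gives decay at each fixed point
    off the pole. *)
Lemma normc_sum_dirichlet2 (N : nat) t :
  nc (cexp t - 1) ^+ 2 * nc (\sum_(0 <= n < N) dirichlet n t) <= 4.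
Proof.
rewrite expr2 -!Normc.normcM -expr2 sum_dirichletM (le_trans (le_normcD _ _))//.
rewrite (le_trans (lerD (le_normcD _ _) (lexx _)))//.
rewrite normcN Normc.normcM !normc_cexp (_ : 2 = (2%:R)%:C); last by rewrite rmorph_nat.
by rewrite normc_real normr_nat; lra.
Qed.

Lemma cexp_2pi_int (k : int) : cexp (k%:~R * (2 * pi)) = 1 :> C.
Proof.
have nat1 (n : nat) : cexp (n%:R * (2 * pi)) = 1 :> C.
  elim: n => [|n IH]; first by rewrite mul0r cexp0.
  rewrite -natr1 mulrDl mul1r cexpD IH mul1r.
  by rewrite mulr_natl /cexp cos2pi sin2pi.
case: k => n; first exact: nat1.
rewrite NegzE mulrNz mulNr -conjc_cexp nat1.
by rewrite conjc1.
Qed.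

Lemma cmeas_cexp_affine (a b : R) : cmeas (fun x => cexp (a * (b - x)) : C).
Proof.
apply: cmeas_cexp => x; apply: cvgM; first exact: cvg_cst.
by apply: cvgB; [exact: cvg_cst|exact: cvg_id].
Qed.

Lemma cmeas_cexpM (a : R) : cmeas (fun x => cexp (- (a * x)) : C).
Proof.
by apply: cmeas_cexp => x; apply: cvgN; apply: cvgM; [exact: cvg_cst|exact: cvg_id].
Qed.

Lemma Rintegral_I01 (f : R -> R) : continuous f ->
  Rintegral mu I f = Rintegral mu `[0, 1]%classic f.
Proof.
move=> cf.
have ic : mu.-integrable `[0, 1]%classic (EFin \o f).
  apply: continuous_compact_integrable; first exact: segment_compact.
  exact: continuous_subspaceT.
rewrite /I01 Rintegral_itv_obnd_cbnd; last first.
  by apply: integrableS ic => //; exact: subset_itv_oo_cc.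
rewrite Rintegral_itv_bndo_bndc//.
by apply: integrableS ic => //; exact: subset_itv_co_cc.
Qed.

Lemma Cint_cexp_int (k : int) : Cint (fun x => cexp (- (k%:~R * (2 * pi) * x)) : C) = (k == 0)%:R.
Proof.
have [->|k0] := eqVneq k 0.
  rewrite (_ : (fun x => _) = fun=> 1); last first.
    by apply/funext => x; rewrite !mul0r oppr0 cexp0.
  have mI : measurable I by exact: measurable_I01.
  apply: complex_eqP; rewrite /Cint /= Rintegral_cst ?mul1r ?mul0r//.
  exact: (congr1 fine (@lebesgue_measure_I01 R)).
set lam := k%:~R * (2 * pi).
have lam0 : lam != 0 by rewrite mulf_neq0 ?intr_eq0// mulf_neq0// gt_eqF// pi_gt0.
have := cexp_2pi_int k; rewrite -/lam => -[coslam sinlam].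
have integ (f : R -> R) : continuous f -> mu.-integrable `[0, 1]%classic (EFin \o f).
  move=> cf; apply: continuous_compact_integrable; first exact: segment_compact.
  exact: continuous_subspaceT.
have ccos := @continuous_cosM R lam; have csin := @continuous_sinM R lam.
apply: complex_eqP => /=.
  under eq_Rintegral do rewrite cosN.
  rewrite Rintegral_I01//; apply: (mulfI lam0).
  rewrite -RintegralZl//; last exact: integ.
  rewrite (Rintegral_FTC2 ltr01 _ (is_derive_sinM lam)); last first.
    by move=> x; apply: cvgM; [exact: cvg_cst|exact: ccos].
  by rewrite mulr1 sinlam !mulr0 sin0 subrr.
under eq_Rintegral do rewrite sinN -[- _]mulN1r.
rewrite RintegralZl//; last 2 first.
  exact: measurable_I01.
  by apply: integrableS (integ _ csin) => //; [exact: measurable_I01|exact: subset_itv_oo_cc].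
rewrite Rintegral_I01//; apply: (mulfI lam0).
rewrite mulrCA -RintegralZl//; last exact: integ.
rewrite mulN1r -[- _]mulN1r -RintegralZl//; last first.
  by apply: integ => x; apply: cvgM; [exact: cvg_cst|exact: csin].
under eq_Rintegral do rewrite mulN1r.
rewrite (Rintegral_FTC2 ltr01 _ (is_derive_cosM lam)); last first.
  by move=> x; apply: cvgN; apply: cvgM; [exact: cvg_cst|exact: csin].
by rewrite mulr1 coslam !mulr0 cos0 subrr.
Qed.

End dirichlet_kernel.

Section fourier_inversion.
Context {R : realType}.
Local Notation C := R[i].
Local Notation nc := (@Normc.normc R).
Local Notation mu := (@lebesgue_measure R).
Local Notation I := (@I01 R).

Definition cmean (b : nat -> C) (N : nat) : C :=
  (N.+1%:R^-1)%:C * \sum_(0 <= n < N.+1) b n.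

Lemma ccvg_cmean (b : nat -> C) l : ccvg b l -> ccvg (cmean b) l.
Proof.
move=> [/cesaro b1 /cesaro b2]; split.
  rewrite (_ : (fun n => _) = arithmetic_mean (fun n => complex.Re (b n)))//.
  apply/funext => N; rewrite /cmean Re_mulc /= mul0r subr0 Re_sum.
  by rewrite /arithmetic_mean /= seriesEnat.
rewrite (_ : (fun n => _) = arithmetic_mean (fun n => complex.Im (b n)))//.
apply/funext => N; rewrite /cmean Im_mulc /= mul0r addr0 Im_sum.
by rewrite /arithmetic_mean /= seriesEnat.
Qed.

Lemma fcoefE s (f : R -> C) k :
  fcoef s f k = Cint (fun x => f x * cexp (- ((freq s k)%:~R * pi * x))).
Proof. by []. Qed.

Lemma cmeas_dirichlet n (x0 : R) :
  cmeas (fun x => dirichlet n (2 * pi * (x0 - x)) : C).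
Proof.
apply: cmeas_sum => k.
rewrite (_ : (fun x => _) = fun x => cexp (k%:~R * (2 * pi) * (x0 - x))).
  exact: cmeas_cexp_affine.
by apply/funext => x; rewrite mulrA.
Qed.

(** A crude bound growing with n; it serves only the integrability of each single kernel. *)
Lemma normc_dirichlet n (t : R) : nc (dirichlet n t) <= (size (rng n))%:R.
Proof.
rewrite (le_trans (normc_sum _ _))//; under eq_bigr do rewrite normc_cexp.
by rewrite big_const_seq count_predT iter_addr addr0.
Qed.

Lemma Cint_dirichlet n (x0 : R) :
  Cint (fun x => dirichlet n (2 * pi * (x0 - x)) : C) = 1.
Proof.
rewrite Cint_sum => [|k]; last first.
  apply: (@cintegrable_bounded _ _ 1) => [|x _]; last by rewrite normc_cexp.
  rewrite (_ : (fun x => _) = fun x => cexp (k%:~R * (2 * pi) * (x0 - x))).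
    exact: cmeas_cexp_affine.
  by apply/funext => x; rewrite mulrA.
transitivity (\sum_(k <- rng n) (cexp (k%:~R * (2 * pi) * x0) * (k == 0)%:R : C)).
  apply: eq_bigr => k _; rewrite -Cint_cexp_int -CintZ.
    by apply: eq_Cint => x _; rewrite -cexpD mulrA mulrBr.
  apply: (@cintegrable_bounded _ _ 1) => [|x _]; last by rewrite normc_cexp.
  exact: cmeas_cexpM.
rewrite (bigD1_seq 0) ?uniq_rng ?mem_rng//= big1 => [|k /negPf ->]; last by rewrite mulr0.
by rewrite !mul0r cexp0 mulr1 addr0.
Qed.

Section inversion.
Variables (s : pm) (phi : R -> C) (x0 L B : R).
Hypotheses (Ix0 : I x0) (mphi : cmeas phi) (L0 : 0 <= L).
Hypothesis lip : forall x, I x -> nc (phi x - phi x0) <= L * `|x - x0|.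
Hypothesis sumB : forall N, \sum_(k <- rng N) nc (fcoef s phi k) <= B.

Let a k := fcoef s phi k * cexp ((freq s k)%:~R * pi * x0).
(** Since freq s k times pi is 2 pi k + p, twisting by cexp (p (x0 - x)) reduces odd modes to even
    ones, so one kernel serves both parities. The twisted difference [psi] vanishes at x0 and is
    bounded by M |x - x0|. *)
Let p : R := (par s)%:~R * pi.
Let psi x := phi x * cexp (p * (x0 - x)) - phi x0.
Let M := L + nc (phi x0) * `|p|.

Let M0 : 0 <= M. Proof. by rewrite addr_ge0// mulr_ge0// normc_ge0. Qed.

Let mpsi : cmeas psi.
Proof.
apply: cmeasD; last exact: cmeas_cst.
by apply: cmeasM => //; exact: cmeas_cexp_affine.
Qed.

Let dist1 x : I x -> `|x - x0| <= 1.
Proof.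
by move: Ix0; rewrite /I01/= !in_itv/= => /andP[? ?] /andP[? ?]; rewrite ler_norml; lra.
Qed.

Let psi_le x : I x -> nc (psi x) <= M * `|x - x0|.
Proof.
move=> Ix; rewrite (_ : psi x = (phi x - phi x0) * cexp (p * (x0 - x))
  + phi x0 * (cexp (p * (x0 - x)) - 1)); last by rewrite /psi; ring.
rewrite (le_trans (le_normcD _ _))// !Normc.normcM normc_cexp mulr1 /M mulrDl.
apply: lerD; first exact: lip.
rewrite -[leRHS]mulrA ler_wpM2l ?normc_ge0// (le_trans (normc_cexp_sub1_le _))//.
by rewrite normrM (distrC x0).
Qed.

Let phi_bd x : I x -> nc (phi x) <= L + nc (phi x0).
Proof.
move=> Ix; have := le_normcD (phi x - phi x0) (phi x0); rewrite subrK => /le_trans; apply.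
by rewrite lerD2r (le_trans (lip Ix))// ler_piMr// dist1.
Qed.

Let iphi : cintegrable phi.
Proof. exact: cintegrable_bounded phi_bd. Qed.

(** The partial sum is an integral against the Dirichlet kernel; the kernel has integral one, so the
    constant phi x0 goes under the integral. *)
Let psum_sub n : psum a n - phi x0 = Cint (fun x => psi x * dirichlet n (2 * pi * (x0 - x))).
Proof.
have mE (k : int) : cmeas (fun x => cexp (- ((freq s k)%:~R * pi * x)) : C).
  exact: cmeas_cexpM.
have iE (k : int) : cintegrable (fun x => phi x * cexp (- ((freq s k)%:~R * pi * x)) : C).
  by apply: (@cintegrableMb _ _ _ 1) => // x _; rewrite normc_cexp.
have iD : cintegrable (fun x => dirichlet n (2 * pi * (x0 - x)) : C).
  apply: (@cintegrable_bounded _ _ (size (rng n))%:R); first exact: cmeas_dirichlet.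
  by move=> x _; exact: normc_dirichlet.
transitivity (Cint (fun x => phi x * cexp (p * (x0 - x)) * dirichlet n (2 * pi * (x0 - x))
    + (- phi x0) * dirichlet n (2 * pi * (x0 - x)))); last first.
  by apply: eq_Cint => x _; rewrite /psi mulrBl mulNr.
rewrite CintD; last 2 first.
- apply: (@cintegrableMb _ _ _ (size (rng n))%:R).
  + apply: (@cintegrableMb _ _ _ 1) => //; first exact: cmeas_cexp_affine.
    by move=> x _; rewrite normc_cexp.
  + exact: cmeas_dirichlet.
  + by move=> x _; exact: normc_dirichlet.
- exact: cintegrableZ.
rewrite CintZ// Cint_dirichlet mulr1; congr (_ - _).
rewrite psumE (eq_bigr (fun k => Cint (fun x => cexp ((freq s k)%:~R * pi * x0) *
   (phi x * cexp (- ((freq s k)%:~R * pi * x)))))); last first.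
  by move=> k _; rewrite CintZ// /a mulrC.
rewrite -Cint_sum => [|k]; last exact: cintegrableZ.
apply: eq_Cint => x _; rewrite /dirichlet mulr_sumr; apply: eq_bigr => k _.
rewrite [LHS]mulrCA -[RHS]mulrA -!cexpD; congr (_ * cexp _).
by rewrite /p /freq intrD intrM -[2%:~R]/(2 : R); ring.
Qed.

Let kern N x : C := cmean (fun n => dirichlet n (2 * pi * (x0 - x))) N.

Let mkern N : cmeas (kern N).
Proof.
apply: cmeasM; first exact: cmeas_cst.
by apply: cmeas_sum => n; exact: cmeas_dirichlet.
Qed.

Let cmean_sub N : cmean (psum a) N - phi x0 = Cint (fun x => psi x * kern N x).
Proof.
have ipsi : cintegrable psi.
  apply: (@cintegrable_bounded _ _ M) => // x Ix.
  by rewrite (le_trans (psi_le Ix))// ler_piMr// dist1.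
transitivity ((N.+1%:R^-1)%:C * \sum_(0 <= n < N.+1) (psum a n - phi x0)).
  rewrite /cmean big_split/= mulrDr; congr (_ + _).
  rewrite sumr_const_nat subn0 -(mulr_natl (- phi x0)) mulrA.
  by rewrite fmorphV rmorph_nat mulVf ?mul1r// pnatr_eq0.
under eq_bigr do rewrite psum_sub.
have iD n : cintegrable (fun x => psi x * dirichlet n (2 * pi * (x0 - x))).
  apply: (@cintegrableMb _ _ _ (size (rng n))%:R) => //.
    exact: cmeas_dirichlet.
  by move=> x _; exact: normc_dirichlet.
rewrite -Cint_sum// -CintZ; last exact: cintegrable_sum.
apply: eq_Cint => x _; rewrite /kern /cmean.
by rewrite [RHS]mulrCA; congr (_ * _); rewrite mulr_sumr.
Qed.

Lemma fourier_inversion_at : ccvg (psum a) (phi x0).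
Proof.
have aS : ccvg (psum a) (Csum a).
  apply: (@ccvg_psum _ _ B) => N; apply: le_trans (sumB N).
  by apply: ler_sum => k _; rewrite Normc.normcM normc_cexp mulr1.
(* Absolute summability already gives the partial sums a limit. Their Cesaro means share it, so the
   limit may be identified on the means. *)
suff h : ccvg (fun N => cmean (psum a) N - phi x0) 0.
  suff -> : phi x0 = Csum a by [].
  apply: (@ccvg_unique _ (cmean (psum a))); last exact: ccvg_cmean.
  rewrite (_ : cmean _ = fun N => (cmean (psum a) N - phi x0) + phi x0); last first.
    by apply/funext => N; rewrite subrK.
  by rewrite -[X in ccvg _ X]add0r; apply: ccvgD => //; exact: ccvg_cst.
rewrite (_ : (fun N => _) = fun N => Cint (fun x => psi x * kern N x)); last first.
  by apply/funext => N; exact: cmean_sub.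
have Ix0' : 0 < x0 < 1 by move: Ix0; rewrite /I01/= in_itv.
have [K K0 HK] := norm_le_normc_cexp_sub1 Ix0'.
have HK' x : I x -> nc (psi x) <= M * K * nc (cexp (2 * pi * (x0 - x)) - 1).
  move=> Ix; rewrite (le_trans (psi_le Ix))// -mulrA ler_wpM2l// HK//.
have kernE N x : nc (kern N x) =
    N.+1%:R^-1 * nc (\sum_(0 <= n < N.+1) dirichlet n (2 * pi * (x0 - x))).
  by rewrite Normc.normcM normc_real ger0_norm.
have k1 N x : nc (cexp (2 * pi * (x0 - x)) - 1) * nc (kern N x) <= 2.
  rewrite kernE mulrCA ler_pdivrMl ?ltr0n// [leRHS]mulrC.
  exact: normc_sum_dirichlet1.
have k2 N x : nc (cexp (2 * pi * (x0 - x)) - 1) ^+ 2 * nc (kern N x) <= N.+1%:R^-1 * 4.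
  by rewrite kernE mulrCA ler_wpM2l//; exact: normc_sum_dirichlet2.
rewrite -(@Cint0 R).
(* The factor contributed by [psi] turns [k1] into a constant majorant. *)
apply: (@Cint_dominated_cvg _ _ _ (cst (M * K * 2))).
- by move=> N; exact: cmeasM.
- exact: cmeas_cst.
- exact: integrable_cst_I01.
- move=> N x Ix; rewrite Normc.normcM.
  rewrite (le_trans (ler_wpM2r (normc_ge0 _) (HK' _ Ix)))// -[leLHS]mulrA /=.
  by apply: ler_wpM2l; [rewrite mulr_ge0|exact: k1].
move=> x Ix; have [->|xx0] := eqVneq x x0.
  rewrite /psi subrr mulr0 cexp0 mulr1 subrr.
  by under [X in ccvg X]eq_fun do rewrite mul0r; exact: ccvg_cst.
set w := nc (cexp (2 * pi * (x0 - x)) - 1).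
have w0 : 0 < w.
  rewrite lt_neqAle normc_ge0 andbT eq_sym; apply/eqP => w0.
  have := HK x; rewrite -/w w0 mulr0; move: Ix; rewrite /I01/= in_itv/= => -> /(_ isT).
  by rewrite normr_le0 subr_eq0 (negPf xx0).
apply/ccvgP.
(* Away from x0, [psi] absorbs one of the two factors w of [k2]; the other stays as 1 / w, and the
   product decays like 1 / N. *)
apply: (@squeeze_cvgr _ _ _ _ (cst 0) (fun N => N.+1%:R^-1 * (4 * (M * K) / w))).
- near=> N; rewrite normc_ge0 subr0 Normc.normcM/=.
  rewrite [leRHS](_ : _ = (M * K * (N.+1%:R^-1 * 4)) / w); last by ring.
  rewrite ler_pdivlMr//.
  apply: (@le_trans _ _ (M * K * (w ^+ 2 * nc (kern N x)))).
    rewrite [leRHS](_ : _ = M * K * w * (nc (kern N x) * w)); last by ring.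
    rewrite -[leLHS]mulrA; apply: ler_wpM2r; last exact: HK'.
    by rewrite mulr_ge0 ?normc_ge0.
  by apply: ler_wpM2l; [rewrite mulr_ge0|exact: k2].
- exact: cvg_cst.
- rewrite -[X in _ --> X](mul0r (4 * (M * K) / w)); apply: cvgM; last exact: cvg_cst.
  exact: cvg_harmonic.
Unshelve. all: by end_near. Qed.

End inversion.

(* The Lipschitz bound at [x0] cancels one of the two poles of the Cesaro mean of the
   Dirichlet kernel, so dominated convergence applies without positivity of the kernel. *)
Lemma fourier_inversion s (phi : R -> C) (x0 L B : R) : I x0 -> cmeas phi ->
  0 <= L -> (forall x, I x -> nc (phi x - phi x0) <= L * `|x - x0|) ->
  (forall N, \sum_(k <- rng N) nc (fcoef s phi k) <= B) ->
  ccvg (psum (fun k => fcoef s phi k * cexp ((freq s k)%:~R * pi * x0))) (phi x0).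
Proof. by move=> Ix0 mphi L0 lip sumB; apply: (@fourier_inversion_at s phi x0 L B). Qed.

End fourier_inversion.

(** * Polynomial cutoff functions *)

Section polynomials.
Context {R : realType}.
Implicit Types (Q : {poly R}).

(** Induction on Q X + r. The two bounds are proved together because the Lipschitz constant of Q X
    involves the bound of Q. *)
Lemma horner_bounded_lipschitz Q : exists B L : R, [/\ 0 <= B, 0 <= L &
  forall x y, 0 <= x <= 1 -> 0 <= y <= 1 ->
    `|Q.[x]| <= B /\ `|Q.[x] - Q.[y]| <= L * `|x - y|].
Proof.
elim/poly_ind: Q => [|Q r [B [L [B0 L0 QBL]]]].
  by exists 0, 0; split => // x y _ _; rewrite !horner0 subrr normr0 mul0r.
exists (B + `|r|), (L + B); split; rewrite ?addr_ge0// => x y hx hy.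
have [Bx Lxy] := QBL _ _ hx hy; have [By _] := QBL _ _ hy hx.
have [x0 x1] := andP hx; have nx : `|x| <= 1 by rewrite ger0_norm.
rewrite !hornerE; split.
  rewrite (le_trans (ler_normD _ _))// lerD2r normrM -[leRHS]mulr1.
  by rewrite ler_pM.
have -> : Q.[x] * x + r - (Q.[y] * y + r) = (Q.[x] - Q.[y]) * x + Q.[y] * (x - y) by ring.
rewrite (le_trans (ler_normD _ _))// [leRHS]mulrDl lerD// normrM.
  by rewrite (le_trans _ Lxy)// ler_piMr.
by rewrite ler_wpM2r.
Qed.

Lemma derivn_exp_factor (T S : {poly R}) (n j : nat) : (j <= n)%N ->
  exists S', derivn j (T ^+ n * S) = T ^+ (n - j) * S'.
Proof.
elim: j => [_|j IH jn]; first by exists S; rewrite subn0.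
have [S' E] := IH (ltnW jn).
exists (deriv T *+ (n - j) * S' + T * deriv S').
rewrite derivnS E derivM deriv_exp (_ : (n - j = (n - j.+1).+1)%N); last lia.
by rewrite /= exprS; ring.
Qed.

End polynomials.

Section cutoff.
Context {R : realType}.
Local Notation C := R[i].
Local Notation nc := (@Normc.normc R).
Local Notation mu := (@lebesgue_measure R).
Local Notation I := (@I01 R).
Variables (c d : R).
Hypotheses (c0 : 0 < c) (cd : c < d) (d1 : d < 1).
Implicit Types Q : {poly R}.

(** The projection onto [c, d], which is 1-Lipschitz. Composed with a polynomial vanishing at c and
    d it gives the extension by zero, with Lipschitz bound and measurability inherited from the
    polynomial. *)
Definition clamp (x : R) := Num.max c (Num.min x d).

Definition cutoff Q (x : R) : C := (Q.[clamp x])%:C.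

Lemma clamp_in x : c <= x <= d -> clamp x = x.
Proof. by move=> /andP[cx xd]; rewrite /clamp (min_idPl xd); apply/max_idPr. Qed.

Lemma clamp_itv x : 0 <= clamp x <= 1.
Proof.
by rewrite /clamp le_max (ltW c0) ge_max ge_min (ltW d1) (ltW (lt_trans cd d1)) orbT.
Qed.

Lemma clamp_lipschitz x y : `|clamp x - clamp y| <= `|x - y|.
Proof.
have minL : `|Num.min x d - Num.min y d| <= `|x - y|.
  case: (leP x d) => xd; case: (leP y d) => yd; rewrite ?subrr ?normr0//.
    by rewrite distrC (distrC x) !ger0_norm; lra.
  by rewrite !ger0_norm; lra.
apply: le_trans minL; rewrite /clamp; move: (Num.min x d) (Num.min y d) => {}x {}y.
case: (leP c x) => cx; case: (leP c y) => cy; rewrite ?subrr ?normr0//.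
  by rewrite !ger0_norm; lra.
by rewrite distrC (distrC x) !ger0_norm; lra.
Qed.

Lemma cutoff_in Q x : c <= x <= d -> cutoff Q x = (Q.[x])%:C.
Proof. by move=> h; rewrite /cutoff clamp_in. Qed.

Lemma cutoff_out Q x : Q.[c] = 0 -> Q.[d] = 0 -> ~~ (c < x < d) -> cutoff Q x = 0.
Proof.
move=> Qc Qd; rewrite negb_and -!leNgt /cutoff /clamp => /orP[xc|dx].
  have -> : Num.min x d = x by apply/min_idPl; exact: le_trans xc (ltW cd).
  by rewrite (max_idPl xc) Qc.
by rewrite (min_idPr dx) (max_idPr (ltW cd)) Qd.
Qed.

Lemma cutoff_lipschitz Q : exists2 L, 0 <= L &
  forall x y, nc (cutoff Q x - cutoff Q y) <= L * `|x - y|.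
Proof.
have [B [L [_ L0 QL]]] := horner_bounded_lipschitz Q; exists L => // x y.
have [_ h] := QL _ _ (clamp_itv x) (clamp_itv y).
rewrite /cutoff -rmorphB normc_real (le_trans h)// ler_wpM2l//.
exact: clamp_lipschitz.
Qed.

Lemma cutoff_bounded Q : exists2 B, 0 <= B & forall x, nc (cutoff Q x) <= B.
Proof.
have [B [L [B0 _ QB]]] := horner_bounded_lipschitz Q; exists B => // x.
by have [h _] := QB _ _ (clamp_itv x) (clamp_itv x); rewrite /cutoff normc_real.
Qed.

Lemma cmeas_cutoff Q : cmeas (cutoff Q).
Proof.
apply: cmeas_real; apply: measurable_funTS; apply: (@measurableT_comp _ _ _ _ _ _ (horner Q)).
  by apply: continuous_measurable_fun; exact: continuous_horner.
by apply: measurable_maxr => //; apply: measurable_minr.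
Qed.

Lemma conjc_cutoff Q x : conjc (cutoff Q x) = cutoff Q x.
Proof. by rewrite /cutoff conjc_real. Qed.

Lemma Rintegral_cutoff Q (h : R -> R) : Q.[c] = 0 -> Q.[d] = 0 ->
  Rintegral mu I (fun x => complex.Re (cutoff Q x) * h x) =
  Rintegral mu `[c, d]%classic (fun x => Q.[x] * h x).
Proof.
move=> Qc Qd; rewrite Rintegral_mkcond [RHS]Rintegral_mkcond.
apply: eq_Rintegral => x _; rewrite !patchE.
have [xcd|xcd] := boolP (c <= x <= d).
  have -> : x \in `[c, d]%classic by rewrite inE /= in_itv.
  have -> : x \in I.
    move: xcd => /andP[cx xd]; rewrite inE /I01/= in_itv/=.
    by rewrite (lt_le_trans c0 cx) (le_lt_trans xd d1).
  by rewrite cutoff_in.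
have -> : (x \in `[c, d]%classic) = false.
  by apply/negbTE; rewrite notin_setE /= in_itv/=; exact/negP.
case: ifPn => // _; rewrite cutoff_out ?mul0r//.
by apply: contra xcd => /andP[? ?]; rewrite !ltW.
Qed.

Lemma fcoef_cutoff s Q k : Q.[c] = 0 -> Q.[d] = 0 ->
  let lam := (freq s k)%:~R * pi in
  fcoef s (cutoff Q) k =
   (Rintegral mu `[c, d]%classic (fun x => Q.[x] * cos (lam * x))) +i*
   (- Rintegral mu `[c, d]%classic (fun x => Q.[x] * sin (lam * x))).
Proof.
move=> Qc Qd lam; apply: complex_eqP => /=.
  rewrite -Rintegral_cutoff//; apply: eq_Rintegral => x _.
  by rewrite /= mul0r subr0 cosN.
rewrite -mulN1r -RintegralZl//; last first.
  apply: continuous_compact_integrable; first exact: segment_compact.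
  apply: continuous_subspaceT => x; apply: cvgM; first exact: continuous_horner.
  exact: continuous_sinM.
under [RHS]eq_Rintegral do rewrite mulN1r -mulrN.
rewrite -Rintegral_cutoff//; apply: eq_Rintegral => x _.
by rewrite /= mul0r addr0 sinN.
Qed.

(** One integration by parts. The zeros of Q remove the boundary terms; those of its derivative make
    the cutoff of the derivative an extension by zero as well. *)
Lemma fcoef_cutoff_deriv s Q k : Q.[c] = 0 -> Q.[d] = 0 ->
  (deriv Q).[c] = 0 -> (deriv Q).[d] = 0 ->
  fcoef s (cutoff (deriv Q)) k = (0 +i* ((freq s k)%:~R * pi)) * fcoef s (cutoff Q) k.
Proof.
move=> Qc Qd Qc' Qd'; rewrite !fcoef_cutoff//; set lam := (freq s k)%:~R * pi.
have integ (f : R -> R) : continuous f -> mu.-integrable `[c, d]%classic (EFin \o f).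
  move=> cf; apply: continuous_compact_integrable; first exact: segment_compact.
  exact: continuous_subspaceT.
have cc (S : {poly R}) : continuous (fun x : R => S.[x] * cos (lam * x)).
  by move=> x; apply: cvgM; [exact: continuous_horner|exact: continuous_cosM].
have cs (S : {poly R}) : continuous (fun x : R => S.[x] * sin (lam * x)).
  by move=> x; apply: cvgM; [exact: continuous_horner|exact: continuous_sinM].
have := @Rintegral_poly_cos R Q lam c d cd.
rewrite Qc Qd !mul0r subrr RintegralB//; last 2 first.
- exact/integ/cc.
- by apply: integ => x; apply: cvgM; [exact: cvg_cst|exact: cs].
rewrite RintegralZl//; last exact/integ/cs.
move=> /eqP; rewrite subr_eq0 => /eqP E1.
have := @Rintegral_poly_sin R Q lam c d cd.
rewrite Qc Qd !mul0r subrr RintegralD//; last 2 first.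
- exact/integ/cs.
- by apply: integ => x; apply: cvgM; [exact: cvg_cst|exact: cc].
rewrite RintegralZl//; last exact/integ/cc.
move=> /eqP; rewrite addr_eq0 => /eqP E2.
by rewrite E1 E2; apply: complex_eqP; rewrite (Re_mulc, Im_mulc) /=; ring.
Qed.

(** The factor 2 comes from bounding real and imaginary parts separately. *)
Lemma normc_Cint_le (F : R -> C) B : cmeas F -> (forall x, I x -> nc (F x) <= B) ->
  nc (Cint F) <= 2 * B.
Proof.
move=> mF FB; have [i1 i2] := cintegrable_bounded mF FB.
have mI : measurable I by exact: measurable_I01.
have muI : fine (mu I) = 1 by exact: (congr1 fine (@lebesgue_measure_I01 R)).
have le h : mu.-integrable I (EFin \o h) -> (forall x, I x -> `|h x| <= B) ->
    `|Rintegral mu I h| <= B.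
  move=> ih hB; rewrite (le_trans (le_normr_Rintegral _ ih))//.
  rewrite -[leRHS]mulr1 -muI -Rintegral_cst//; apply: le_Rintegral => //.
    exact: integrable_norm.
  exact: integrable_cst_I01.
rewrite (le_trans (normc_le_ReIm _))// mulr_natl mulr2n lerD//; apply: le => // x Ix.
  by rewrite (le_trans (Re_le_normc _))// FB.
by rewrite (le_trans (Im_le_normc _))// FB.
Qed.

Lemma fcoef_cutoff_bounded s Q : exists2 A, 0 <= A &
  forall k, nc (fcoef s (cutoff Q) k) <= A.
Proof.
have [B B0 QB] := cutoff_bounded Q; exists (2 * B) => [|k]; first by rewrite mulr_ge0.
rewrite fcoefE; apply: normc_Cint_le.
  by apply: cmeasM; [exact: cmeas_cutoff|exact: cmeas_cexpM].
by move=> x _; rewrite Normc.normcM normc_cexp mulr1.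
Qed.

End cutoff.

(** * Decay of coefficients from bounds on derivatives *)

Section decay.
Context {R : realType}.
Local Notation C := R[i].
Local Notation nc := (@Normc.normc R).

Lemma normcX (z : C) n : nc (z ^+ n) = nc z ^+ n.
Proof.
elim: n => [|n IH]; first by rewrite !expr0 Normc.normc1.
by rewrite !exprS Normc.normcM IH.
Qed.

Lemma normc_imag (t : R) : nc (0 +i* t) = `|t|.
Proof. by rewrite /= expr0n add0r sqrtr_sqr. Qed.

Lemma jbrE (n : int) : jbr R n = 1 + `|n%:~R|.
Proof. by rewrite /jbr intr_norm. Qed.

Lemma jbr_ge1 (n : int) : 1 <= jbr R n.
Proof. by rewrite jbrE lerDl. Qed.

Lemma jbr_freq_ge s (k : int) : 1 + `|k%:~R| <= jbr R (freq s k).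
Proof.
rewrite jbrE lerD2l -!intr_norm ler_int /freq /par.
by case: s; lia.
Qed.

Lemma sum_rng_inv_sqr N : \sum_(k <- rng N) ((1 + `|k%:~R|) ^- 2 : R) <= 4.
Proof.
(* Strengthened for the induction: with x = N + 2, the two new terms give 2 / x^2, at most 4 / x - 4
   / (x + 1). *)
suff : \sum_(k <- rng N) ((1 + `|k%:~R|) ^- 2 : R) <= 4 - 4 / (N.+2)%:R.
  by move=> /le_trans; apply; rewrite gerBl divr_ge0.
elim: N => [|N IH].
  by rewrite big_seq1 normr0 addr0 expr1n invr1; lra.
rewrite rng_recr mulrNz normrN ger0_norm ?ler0z//.
rewrite (le_trans (lerD IH (lexx _)))// -[N.+1%:Z%:~R]/(N.+1%:R : R).
have -> : 1 + N.+1%:R = N.+2%:R :> R by rewrite addrC natr1.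
have -> : N.+3%:R = N.+2%:R + 1 :> R by rewrite natr1.
have : 1 <= N.+2%:R :> R by rewrite ler1n.
move: (N.+2%:R : R) => x x1.
rewrite -subr_ge0 (_ : _ - _ = (2 * (x - 1)) / (x ^+ 2 * (x + 1))).
  by rewrite divr_ge0 ?mulr_ge0 ?exprn_ge0//; lra.
by field; rewrite !gt_eqF//; lra.
Qed.

(** Two spare powers of the bracket pay for the summable factor. At a nonzero frequency 1 + |f| <= 2
    |f pi|; at frequency zero the bracket is 1 and the plain [X] suffices. In use, [X] is the
    modulus of a coefficient and the second term that of the derivative of order n + 2. *)
Lemma jbr_decay s (k : int) (n : nat) (X : R) : 0 <= X ->
  jbr R (freq s k) ^+ n * X <=
  2 ^+ n.+2 * (X + `|(freq s k)%:~R * pi| ^+ n.+2 * X) * (1 + `|k%:~R|) ^- 2.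
Proof.
move=> X0; have J1 := jbr_ge1 (freq s k).
have k0 : 0 < 1 + `|k%:~R : R| by rewrite ltr_pwDl.
rewrite ler_pdivlMr ?exprn_gt0//.
apply: (@le_trans _ _ (jbr R (freq s k) ^+ n.+2 * X)).
  rewrite -(addn2 n) exprD [leRHS]mulrAC ler_wpM2l ?mulr_ge0 ?exprn_ge0//.
    by rewrite (le_trans _ J1).
  by rewrite ler_sqr ?nnegrE; [exact: jbr_freq_ge|exact: ltW|exact: le_trans ler01 J1].
have [->|n0] := eqVneq (freq s k) 0.
  rewrite jbrE normr0 addr0 expr1n mul1r mul0r normr0 expr0n mul0r addr0.
  by rewrite ler_peMl// exprn_ege1// ler1n.
apply: (@le_trans _ _ (2 ^+ n.+2 * (`|(freq s k)%:~R * pi| ^+ n.+2 * X))); last first.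
  by rewrite ler_wpM2l ?exprn_ge0// lerDr.
rewrite [leRHS]mulrA -exprMn ler_wpM2r// lerXn2r// ?nnegrE ?mulr_ge0//.
  exact: le_trans ler01 J1.
have n1 : 1 <= `|(freq s k)%:~R : R|.
  by rewrite -intr_norm ler1z; move: n0; lia.
have p1 := @pi_ge2 R.
rewrite jbrE normrM (ger0_norm (pi_ge0 R)); nra.
Qed.

End decay.

Section test_polynomial.
Context {R : realType}.
Local Notation C := R[i].
Local Notation nc := (@Normc.normc R).
Variables (c d : R) (m : nat).
Hypotheses (c0 : 0 < c) (cd : c < d) (d1 : d < 1).

(** Evenness of the exponent makes the bump nonnegative; its size lets all derivatives up to order
    2m + 2 vanish at both ends. *)
Definition test_poly : {poly R} :=
  (('X - c%:P) * ('X - d%:P)) ^+ (2 * m).+4.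

Lemma test_poly_root j : (j < (2 * m).+4)%N ->
  (derivn j test_poly).[c] = 0 /\ (derivn j test_poly).[d] = 0.
Proof.
move=> jm; have [S] := @derivn_exp_factor R (('X - c%:P) * ('X - d%:P)) 1 _ _ (ltnW jm).
rewrite mulr1 /test_poly => ->; split;
  rewrite hornerM horner_exp hornerM !hornerE subrr ?mul0r ?mulr0;
  by rewrite expr0n subn_eq0 leqNgt jm mul0r.
Qed.

Lemma fcoef_test_derivn s k j : (j <= (2 * m).+2)%N ->
  fcoef s (cutoff c d (derivn j test_poly)) k =
  (0 +i* ((freq s k)%:~R * pi)) ^+ j * fcoef s (cutoff c d test_poly) k.
Proof.
elim: j => [|j IH] jm; first by rewrite expr0 mul1r.
have [? ?] := @test_poly_root j ltac:(lia).
have := @test_poly_root j.+1 ltac:(lia); rewrite derivnS => -[? ?].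
by rewrite fcoef_cutoff_deriv// IH ?(ltnW jm)// exprS mulrA.
Qed.

Lemma test_coef_summable s : exists B, forall N,
  \sum_(k <- rng N) jbr R (freq s k) ^+ (2 * m) * nc (fcoef s (cutoff c d test_poly) k) <= B.
Proof.
have [A1 A10 h1] := fcoef_cutoff_bounded c0 cd d1 s test_poly.
have [A2 A20 h2] := fcoef_cutoff_bounded c0 cd d1 s (derivn (2 * m).+2 test_poly).
exists (2 ^+ (2 * m).+2 * (A1 + A2) * 4) => N.
apply: (@le_trans _ _ (\sum_(k <- rng N) 2 ^+ (2 * m).+2 * (A1 + A2) * (1 + `|k%:~R|) ^- 2)).
  apply: ler_sum => k _; rewrite (le_trans (jbr_decay _ _ _ (normc_ge0 _)))//.
  rewrite ler_wpM2r ?invr_ge0 ?exprn_ge0 ?addr_ge0// ler_wpM2l ?exprn_ge0// lerD//.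
  have := h2 k; rewrite fcoef_test_derivn// Normc.normcM normcX normc_imag.
  by [].
rewrite -mulr_sumr; apply: ler_wpM2l; last exact: sum_rng_inv_sqr.
by apply: mulr_ge0; [exact: exprn_ge0|exact: addr_ge0].
Qed.

End test_polynomial.

(** * Pairing an integrable function with a test function through coefficients *)

Section pairing.
Context {R : realType}.
Local Notation C := R[i].
Local Notation nc := (@Normc.normc R).
Local Notation I := (@I01 R).

(** The coefficient sums are integrals of F against conjugated partial sums of the series of phi.
    These are bounded by B, so a multiple of the norm of F dominates. *)
Lemma ccvg_pairing s (F phi : R -> C) (c : int -> C) B : cintegrable F -> cmeas phi ->
  (forall N, \sum_(k <- rng N) nc (c k) <= B) ->
  (forall x, I x -> ccvg (psum (fun k => c k * cexp ((freq s k)%:~R * pi * x))) (phi x)) ->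
  ccvg (psum (fun k => conjc (c k) * fcoef s F k)) (Cint (fun x => F x * conjc (phi x))).
Proof.
move=> iF mphi cB cphi.
have mF := cintegrable_cmeas iF.
pose S N x : C := psum (fun k => c k * cexp ((freq s k)%:~R * pi * x)) N.
have conjE N x : conjc (S N x) =
    \sum_(k <- rng N) conjc (c k) * cexp (- ((freq s k)%:~R * pi * x)).
  rewrite /S psumE rmorph_sum; apply: eq_bigr => k _.
  by rewrite rmorphM; congr (_ * _); exact: conjc_cexp.
have mS N : cmeas (fun x => conjc (S N x)).
  rewrite (_ : (fun x => _) = fun x => \sum_(k <- rng N)
      conjc (c k) * cexp (- ((freq s k)%:~R * pi * x))).
    apply: cmeas_sum => k; apply: cmeasM; first exact: cmeas_cst.
    exact: cmeas_cexpM.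
  by apply/funext => x; exact: conjE.
rewrite (_ : psum _ = fun N => Cint (fun x => F x * conjc (S N x))); last first.
  apply/funext => N; rewrite psumE.
  have iE (k : int) : cintegrable (fun x => F x * cexp (- ((freq s k)%:~R * pi * x))).
    apply: (@cintegrableMb _ _ _ 1) => //; first exact: cmeas_cexpM.
    by move=> x _; rewrite normc_cexp.
  under eq_bigr do rewrite fcoefE -CintZ//.
  rewrite -Cint_sum => [|k]; last exact: cintegrableZ.
  apply: eq_Cint => x _; rewrite conjE mulr_sumr; apply: eq_bigr => k _.
  by rewrite mulrCA.
apply: (@Cint_dominated_cvg _ _ _ (fun x => ReIm_norm F x * B)).
- by move=> N; exact: cmeasM.
- by apply: cmeasM => //; exact: cmeas_conjc.
- rewrite (_ : EFin \o _ = (fun x => (ReIm_norm F x)%:E * B%:E)%E)//.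
  apply: integrableZr; first exact: measurable_I01.
  exact: integrable_ReIm_norm.
- move=> N x Ix; rewrite Normc.normcM normc_conjc ler_pM ?normc_ge0 ?normc_le_ReIm//.
  rewrite /S psumE (le_trans (normc_sum _ _))//; apply: le_trans (cB N).
  by apply: ler_sum => k _; rewrite Normc.normcM normc_cexp mulr1.
- move=> x Ix; apply: ccvgM; first exact: ccvg_cst.
  by apply: ccvg_conjc; exact: cphi.
Qed.

Lemma ccvg_pairing_cutoff s (F : R -> C) (c d : R) (Q : {poly R}) B :
  0 < c -> c < d -> d < 1 -> cintegrable F ->
  (forall N, \sum_(k <- rng N) nc (fcoef s (cutoff c d Q) k) <= B) ->
  ccvg (psum (fun k => conjc (fcoef s (cutoff c d Q) k) * fcoef s F k))
    (Cint (fun x => F x * cutoff c d Q x)).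
Proof.
move=> c0 cd d1 iF sB.
have [L L0 lip] := cutoff_lipschitz c0 cd d1 Q.
have -> : (fun x => F x * cutoff c d Q x) = (fun x => F x * conjc (cutoff c d Q x)).
  by apply/funext => x; rewrite conjc_cutoff.
apply: (@ccvg_pairing _ _ _ _ B) => //; first exact: cmeas_cutoff.
move=> x Ix; apply: (@fourier_inversion _ _ _ _ L B) => //.
exact: cmeas_cutoff.
Qed.

End pairing.

(** * Multiplication by V on the Fourier side *)

Section multiplication.
Context {R : realType}.
Local Notation C := R[i].
Local Notation nc := (@Normc.normc R).
Local Notation J s k := (jbr R (freq s k)).

Lemma jbr_gt0 (n : int) : 0 < jbr R n.
Proof. exact: lt_le_trans ltr01 (jbr_ge1 _). Qed.

Lemma inH_summableP s (m : nat) (c : int -> C) : inH s m%:Z c ->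
  summable [set: int] (fun k => (J s k ^+ (2 * m) * nc (c k) ^+ 2)%:E).
Proof.
rewrite /inH; congr (summable _ _); apply/funext => k.
by rewrite sqr_normc_cabs2 -PoszM -exprnP.
Qed.

Lemma inH_summableN s (m : nat) (c : int -> C) : inH s (- m%:Z) c ->
  summable [set: int] (fun k => (J s k ^- (2 * m) * nc (c k) ^+ 2)%:E).
Proof.
rewrite /inH; congr (summable _ _); apply/funext => k.
by rewrite sqr_normc_cabs2 mulrN -PoszM -exprnN.
Qed.

(** Peetre's inequality; the difference of two frequencies of equal parity is an even frequency, for
    either choice of [s]. *)
Lemma jbr_freq_sub s (k l : int) : J pl (k - l) <= J s k * J s l.
Proof.
have -> : freq pl (k - l) = freq s k - freq s l by rewrite /freq /par; case: s; lia.
rewrite !jbrE intrB; have := ler_normB ((freq s k)%:~R : R) (freq s l)%:~R.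
have := normr_ge0 ((freq s k)%:~R : R); have := normr_ge0 ((freq s l)%:~R : R).
nra.
Qed.

(** The difference of the two sides is (v - e q w)^2 / (2 e q). The weight [q] will match the norms
    of V and u, while [e] stays free to balance a small tail of V against the full norm of u. *)
Lemma weighted_young (e q v w : R) : 0 < e -> 0 < q ->
  v * w <= 2^-1 * (e^-1 * (q^-1 * v ^+ 2) + e * (q * w ^+ 2)).
Proof.
move=> e0 q0; rewrite -subr_ge0.
have -> : 2^-1 * (e^-1 * (q^-1 * v ^+ 2) + e * (q * w ^+ 2)) - v * w =
  (v - e * q * w) ^+ 2 / (2 * (e * q)) by field; rewrite !gt_eqF.
by rewrite divr_ge0 ?sqr_ge0// !mulr_ge0// ltW.
Qed.

Section product.
Variables (s : pm) (m : nat) (V u : int -> C).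
Hypotheses (hV : inH pl (- m%:Z) V) (hu : inH s m%:Z u).

Let WV j := J pl j ^- (2 * m) * nc (V j) ^+ 2.
Let Wu l := J s l ^+ (2 * m) * nc (u l) ^+ 2.

Let WV0 j : 0 <= WV j.
Proof. by rewrite mulr_ge0 ?sqr_ge0// invr_ge0 exprn_ge0// ltW// jbr_gt0. Qed.

Let Wu0 l : 0 <= Wu l.
Proof. by rewrite mulr_ge0 ?sqr_ge0// exprn_ge0// ltW// jbr_gt0. Qed.

(** Young's inequality with the bracket weight of k - l; on the side of u that weight is then split
    between k and l. *)
Lemma product_term_le e k l : 0 < e ->
  nc (V (k - l) * u l) <= 2^-1 * (e^-1 * WV (k - l) + e * (J s k ^+ (2 * m) * Wu l)).
Proof.
move=> e0; rewrite Normc.normcM.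
have q0 : 0 < J pl (k - l) ^+ (2 * m) by rewrite exprn_gt0// jbr_gt0.
rewrite (le_trans (weighted_young _ _ e0 q0))// ler_wpM2l ?invr_ge0// lerD2l.
rewrite ler_wpM2l ?(ltW e0)// /Wu mulrA ler_wpM2r ?sqr_ge0// -exprMn lerXn2r//.
- by rewrite nnegrE ltW// jbr_gt0.
- by rewrite nnegrE mulr_ge0// ltW// jbr_gt0.
- exact: jbr_freq_sub.
Qed.

Lemma ccvg_mulV k : ccvg (psum (fun l => V (k - l) * u l)) (mulV s V u k).
Proof.
have [BV hBV] := summable_sum_bound WV0 (inH_summableN hV).
have [Bu hBu] := summable_sum_bound Wu0 (inH_summableP hu).
apply: (@ccvg_psum _ _ (2^-1 * (1^-1 * BV + 1 * (J s k ^+ (2 * m) * Bu)))) => N.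
apply: (le_trans (ler_sum _ (fun l _ => product_term_le k l ltr01))).
rewrite -mulr_sumr big_split/= -!mulr_sumr ler_wpM2l ?invr_ge0// lerD//.
  rewrite invr1 !mul1r -(big_map (fun l => k - l) xpredT WV).
  by apply: hBV; rewrite map_inj_uniq ?uniq_rng// => i j /addrI /oppr_inj.
rewrite !mul1r ler_wpM2l ?exprn_ge0//; first exact/ltW/jbr_gt0.
exact/hBu/uniq_rng.
Qed.

(** The bound is proved on windows and passes to the limit. Its dependence on [k] is confined to one
    explicit weight, which is what allows summation against the coefficients of the bump. *)
Lemma mulV_truncation (s0 : seq int) Bu tau e k : uniq s0 -> 0 < e ->
  (forall r, uniq r -> \sum_(i <- r) Wu i <= Bu) ->
  (forall r, uniq r -> (forall i, i \in r -> i \notin s0) -> \sum_(i <- r) WV i <= tau) ->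
  nc (mulV s V u k - \sum_(j <- s0) V j * u (k - j)) <=
  2^-1 * (e^-1 * tau + e * (J s k ^+ (2 * m) * Bu)).
Proof.
move=> us0 e0 hBu htau.
have cv : ccvg (fun N => psum (fun l => V (k - l) * u l) N - \sum_(j <- s0) V j * u (k - j))
    (mulV s V u k - \sum_(j <- s0) V j * u (k - j)).
  by apply: ccvgD; [exact: ccvg_mulV|exact: ccvg_cst].
apply: (ler_cvg_to (ccvg_norm cv) (cvg_cst _)).
(* Once the window contains every k - j with j in [s0], the finite sum cancels exactly and only
   modes of V outside [s0] remain. *)
have [N0 hN0] : exists N0, forall j, j \in s0 -> (absz (k - j) <= N0)%N.
  elim: (s0) => [|i r [N0 h]]; first by exists 0%N.
  exists (maxn (absz (k - i)) N0) => j; rewrite in_cons => /predU1P[->|/h]; first exact: leq_maxl.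
  by move=> /leq_trans; apply; exact: leq_maxr.
exists N0 => // N /= N0N.
have -> : psum (fun l => V (k - l) * u l) N - \sum_(j <- s0) V j * u (k - j) =
    \sum_(l <- [seq l <- rng N | k - l \notin s0]) V (k - l) * u l.
  rewrite psumE [RHS]big_filter [X in X - _](bigID (fun l => k - l \in s0))/=.
  suff -> : \sum_(l <- rng N | k - l \in s0) V (k - l) * u l = \sum_(j <- s0) V j * u (k - j).
    by rewrite addrAC subrr add0r.
  transitivity (\sum_(l <- [seq k - j | j <- s0]) V (k - l) * u l); last first.
    by rewrite big_map; apply: eq_bigr => j _; rewrite subKr.
  rewrite -big_filter; apply: perm_big; apply: uniq_perm.
  - by apply: filter_uniq; exact: uniq_rng.
  - by rewrite map_inj_uniq// => i j /addrI /oppr_inj.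
  - move=> l; rewrite mem_filter mem_rng; apply/andP/mapP => [[kl _]|[j js0 ->]].
      by exists (k - l) => //; rewrite subKr.
    by rewrite subKr; split => //; exact: leq_trans (hN0 _ js0) N0N.
have : uniq [seq l <- rng N | k - l \notin s0] by apply: filter_uniq; exact: uniq_rng.
have : forall l, l \in [seq l <- rng N | k - l \notin s0] -> k - l \notin s0.
  by move=> l; rewrite mem_filter => /andP[].
move: [seq l <- rng N | k - l \notin s0] => r rs0 ur.
rewrite (le_trans (normc_sum _ _))//.
apply: (le_trans (ler_sum _ (fun l _ => product_term_le k l e0))).
rewrite -mulr_sumr big_split/= -!mulr_sumr ler_wpM2l ?invr_ge0// lerD//.
  rewrite ler_wpM2l ?invr_ge0 ?(ltW e0)// -(big_map (fun l => k - l) xpredT WV).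
  apply: htau; first by rewrite map_inj_uniq// => i j /addrI /oppr_inj.
  by move=> i /mapP[l /rs0 h ->].
rewrite ler_wpM2l ?(ltW e0)// ler_wpM2l ?exprn_ge0//; first exact/ltW/jbr_gt0.
exact: hBu.
Qed.

(** For V restricted to a finite set of modes the exchange of sums is algebra, and each inner sum
    tends to zero by assumption. The remainder is bounded independently of the window. *)
Lemma ccvg_mulV_orthogonal (c : int -> C) Bc :
  (forall N, \sum_(k <- rng N) J s k ^+ (2 * m) * nc (c k) <= Bc) ->
  (forall j, ccvg (psum (fun k => conjc (c k) * u (k - j))) 0) ->
  ccvg (psum (fun k => conjc (c k) * mulV s V u k)) 0.
Proof.
move=> hBc orth.
have [Bu hBu] := summable_sum_bound Wu0 (inH_summableP hu).
have Bu0 : 0 <= Bu by have := hBu [::] isT; rewrite big_nil.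
have J1 k : 1 <= J s k ^+ (2 * m) by rewrite exprn_ege1// jbr_ge1.
have Bc0 : 0 <= Bc.
  apply: le_trans (hBc 0%N); apply: sumr_ge0 => k _.
  by rewrite mulr_ge0 ?normc_ge0// (le_trans _ (J1 k)).
have hBc' N : \sum_(k <- rng N) nc (c k) <= Bc.
  apply: le_trans (hBc N); apply: ler_sum => k _.
  by rewrite ler_peMl ?normc_ge0.
apply/ccvgP/cvgrPdist_le => eps eps0.
(* [e] is fixed first, against the full norm of u; [tau] is chosen after it, since it gets divided
   by [e]. The added 1 keeps the denominators positive. *)
pose e := eps / 2 / (Bc * Bu + 1).
have BB : 0 < Bc * Bu + 1 by rewrite ltr_wpDl ?mulr_ge0.
have e0 : 0 < e by rewrite !divr_gt0.
pose tau := e * (eps / 2) / (Bc + 1).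
have Bc1 : 0 < Bc + 1 by rewrite ltr_wpDl.
have tau0 : 0 < tau by rewrite !mulr_gt0 ?invr_gt0.
have [s0 us0 hs0] := summable_sum_tail WV0 (inH_summableN hV) tau0.
have cS : ccvg (fun N => \sum_(j <- s0) V j * psum (fun k => conjc (c k) * u (k - j)) N) 0.
  have := @ccvg_sum R _ s0 (fun j N => V j * psum (fun k => conjc (c k) * u (k - j)) N)
    (fun j => V j * 0) (fun j => ccvgM (ccvg_cst (V j)) (orth j)).
  by rewrite [X in ccvg _ X]big1// => j _; rewrite mulr0.
move/ccvgP/cvgrPdist_le : cS => /(_ (eps / 2)); rewrite divr_gt0// => /(_ isT).
apply: filterS => N; rewrite !sub0r !normrN !subr0 !ger0_norm ?normc_ge0// => hN.
have -> : psum (fun k => conjc (c k) * mulV s V u k) N =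
    \sum_(j <- s0) V j * psum (fun k => conjc (c k) * u (k - j)) N +
    \sum_(k <- rng N) conjc (c k) * (mulV s V u k - \sum_(j <- s0) V j * u (k - j)).
  under [X in _ = _ + X]eq_bigr do rewrite mulrBr.
  rewrite big_split/= sumrN psumE.
  suff -> : \sum_(j <- s0) V j * psum (fun k => conjc (c k) * u (k - j)) N =
      \sum_(k <- rng N) conjc (c k) * (\sum_(j <- s0) V j * u (k - j)).
    by rewrite [RHS]addrC subrK.
  under eq_bigr do rewrite psumE mulr_sumr.
  rewrite exchange_big/=; apply: eq_bigr => k _.
  by rewrite mulr_sumr; apply: eq_bigr => j _; rewrite mulrCA.
rewrite (le_trans (le_normcD _ _))// [leRHS]splitr lerD//.
rewrite (le_trans (normc_sum _ _))//.
apply: (@le_trans _ _ (\sum_(k <- rng N) (2^-1 * (e^-1 * tau) * nc (c k) +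
    2^-1 * (e * Bu) * (J s k ^+ (2 * m) * nc (c k))))).
  apply: ler_sum => k _; rewrite Normc.normcM normc_conjc.
  have := mulV_truncation k us0 e0 hBu hs0.
  move=> /(ler_wpM2l (normc_ge0 (c k)))/le_trans; apply.
  by rewrite le_eqVlt; apply/orP; left; apply/eqP; ring.
rewrite big_split/= -!mulr_sumr.
apply: (@le_trans _ _ (2^-1 * (e^-1 * tau) * Bc + 2^-1 * (e * Bu) * Bc)).
  have e1 : 0 <= e^-1 * tau by apply: mulr_ge0; [rewrite invr_ge0; exact: ltW|exact: ltW].
  have e2 : 0 <= e * Bu by apply: mulr_ge0 => //; exact: ltW.
  by apply: lerD; apply: ler_wpM2l => //; apply: mulr_ge0 => //; rewrite invr_ge0.
have t1 : e^-1 * tau * Bc <= eps / 2.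
  have -> : e^-1 * tau * Bc = (eps / 2) * Bc / (Bc + 1).
    by rewrite /tau; field; rewrite !gt_eqF.
  rewrite ler_pdivrMr// ler_wpM2l ?divr_ge0 ?(ltW eps0)//; lra.
have t2 : e * Bu * Bc <= eps / 2.
  rewrite (_ : e * Bu * Bc = (eps / 2) * (Bc * Bu) / (Bc * Bu + 1)); last by rewrite /e; ring.
  rewrite ler_pdivrMr// ler_wpM2l ?divr_ge0 ?(ltW eps0)//; lra.
lra.
Qed.

End product.

End multiplication.

(** * Orthogonality of the image to the bumps *)

Section orthogonality.
Context {R : realType}.
Local Notation C := R[i].
Local Notation nc := (@Normc.normc R).
Local Notation mu := (@lebesgue_measure R).
Local Notation I := (@I01 R).

Lemma Cint_cutoff_eq0 (F : R -> C) (a b c d : R) (Q : {poly R}) :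
  c < d -> a < c -> d < b -> Q.[c] = 0 -> Q.[d] = 0 -> cmeas F ->
  {ae mu, forall x, a < x < b -> F x = 0} ->
  Cint (fun x => F x * cutoff c d Q x) = 0.
Proof.
move=> cd ac db Qc Qd mF F0; apply: Cint_ae_eq0.
  by apply: cmeasM => //; exact: cmeas_cutoff.
apply: (filterS (Filter := ae_filter_ringOfSetsType mu)) F0 => x Fx _.
have [/andP[cx xd]|xcd] := boolP (c < x < d); last by rewrite cutoff_out ?mulr0.
by rewrite Fx ?mul0r// (lt_trans ac cx) (lt_trans xd db).
Qed.

(** This reads the shifted family u (k - j) as the coefficients of f times an exponential, a
    function that vanishes wherever f does. *)
Lemma fcoef_modulation s (F : R -> C) k j :
  fcoef s (fun x => F x * cexp (2 * j%:~R * pi * x)) k = fcoef s F (k - j).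
Proof.
have E l : (freq s l)%:~R = 2 * l%:~R + (par s)%:~R :> R by rewrite /freq intrD intrM.
rewrite !fcoefE; apply: eq_Cint => x _; rewrite -mulrA -cexpD; congr (_ * cexp _).
by rewrite !E intrB; ring.
Qed.

(** The sign between the ordinary derivative of order 2n and the power of |D|; it is undone later
    because it squares to one. *)
Lemma imag_exp_even (t : R) n : (0 +i* t) ^+ (2 * n) = ((-1) ^+ n)%:C * (t ^+ (2 * n))%:C.
Proof.
rewrite exprM -rmorphM /=.
have -> : (0 +i* t) ^+ 2 = (- t ^+ 2)%:C.
  by apply: complex_eqP; rewrite expr2 (Re_mulc, Im_mulc) /=; ring.
by rewrite -rmorphXn /=; congr (_%:C); rewrite [LHS]exprNn -exprM.
Qed.

Lemma Cint_test_eq0 (m : nat) (V : int -> C) s (u : int -> C) (f g : R -> C) (a b c d : R) :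
  inH pl (- (m%:Z)) V -> inH s m%:Z u ->
  represents s f u -> represents s g (Scoef s m V u) ->
  0 <= a -> b <= 1 -> a < c -> c < d -> d < b ->
  {ae mu, forall x, a < x < b -> f x = 0} ->
  Cint (fun x => g x * cutoff c d (test_poly c d m) x) = 0.
Proof.
move=> hV hu [/inL2_cintegrable intf fu] [/inL2_cintegrable intg gu] a0 b1 ac cd db f0.
have c0 : 0 < c by exact: le_lt_trans a0 ac.
have d1 : d < 1 by exact: lt_le_trans db b1.
have mf := cintegrable_cmeas intf.
set P := test_poly c d m; pose coef k := fcoef s (cutoff c d P) k.
have rootP j : (j < (2 * m).+4)%N -> (derivn j P).[c] = 0 /\ (derivn j P).[d] = 0.
  exact: test_poly_root.
have [Pc Pd] := rootP 0%N isT.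
have [Bc hBc] := test_coef_summable m c0 cd d1 s.
have J1 k : 1 <= jbr R (freq s k) ^+ (2 * m) by rewrite exprn_ege1// jbr_ge1.
have hB N : \sum_(k <- rng N) nc (coef k) <= Bc.
  apply: le_trans (hBc N); apply: ler_sum => k _.
  by rewrite ler_peMl ?normc_ge0.
(* The integral is the limit of the coefficient pairing, so it suffices that this pairing also tends
   to 0, separately for its potential and differential parts. *)
apply: (ccvg_unique (ccvg_pairing_cutoff c0 cd d1 intg hB)).
have cD : ccvg (psum (fun k => conjc (coef k) * mulV s V u k)) 0.
  apply: (ccvg_mulV_orthogonal hV hu hBc) => j.
  have iF : cintegrable (fun x => f x * cexp (2 * j%:~R * pi * x)).
    apply: (@cintegrableMb _ _ _ 1) => // [|x _]; last by rewrite normc_cexp.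
    by apply: cmeas_cexp => x; apply: cvgM; [exact: cvg_cst|exact: cvg_id].
  have := ccvg_pairing_cutoff c0 cd d1 iF hB.
  rewrite (@Cint_cutoff_eq0 _ a b)//; last 2 first.
  - exact: cintegrable_cmeas.
  - apply: (filterS (Filter := ae_filter_ringOfSetsType mu)) f0 => x /[apply] ->.
    by rewrite mul0r.
  rewrite (_ : psum _ = psum (fun k => conjc (coef k) * u (k - j)))//.
  by congr psum; apply/funext => k; rewrite fcoef_modulation fu.
pose lam k : R := (freq s k)%:~R * pi.
(* The factor lam^(2m) is moved onto the bump: up to sign it produces the coefficients of the cutoff
   of its derivative of order 2m, again supported in [c, d]. *)
have cB : ccvg (psum (fun k => conjc (coef k) * ((lam k ^+ (2 * m))%:C * u k))) 0.
  have [Qc Qd] := @rootP (2 * m)%N ltac:(lia).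
  have hB2 N : \sum_(k <- rng N) nc (fcoef s (cutoff c d (derivn (2 * m) P)) k) <=
      pi ^+ (2 * m) * Bc.
    apply: le_trans (ler_wpM2l (exprn_ge0 _ (pi_ge0 R)) (hBc N)).
    rewrite mulr_sumr; apply: ler_sum => k _.
    rewrite fcoef_test_derivn//; last lia.
    rewrite Normc.normcM normcX normc_imag mulrA ler_wpM2r ?normc_ge0//.
    rewrite -exprMn lerXn2r ?nnegrE ?mulr_ge0 ?pi_ge0 ?(ltW (jbr_gt0 _))//.
    by rewrite normrM (ger0_norm (pi_ge0 R)) mulrC ler_wpM2l ?pi_ge0// jbrE lerDr.
  have := ccvg_pairing_cutoff c0 cd d1 intf hB2.
  rewrite (@Cint_cutoff_eq0 _ a b)// => /(ccvgM (ccvg_cst ((-1) ^+ m)%:C)).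
  rewrite mulr0 (_ : (fun n => _) =
    psum (fun k => conjc (coef k) * ((lam k ^+ (2 * m))%:C * u k)))//.
  apply/funext => N; rewrite !psumE mulr_sumr; apply: eq_bigr => k _.
  rewrite fcoef_test_derivn//; last lia.
  rewrite imag_exp_even fu -/(lam k) -/(coef k).
  have -> : conjc (((-1) ^+ m)%:C * (lam k ^+ (2 * m))%:C * coef k) =
      ((-1) ^+ m)%:C * (lam k ^+ (2 * m))%:C * conjc (coef k).
    by rewrite 2!rmorphM; congr (_ * _ * _); exact: conjc_real.
  have : ((-1) ^+ m)%:C * ((-1) ^+ m)%:C = 1 :> C.
    by rewrite -rmorphM /= -exprMn mulrNN mulr1 expr1n.
  move=> E; rewrite -[RHS]mul1r -E; ring.
have := ccvgD cB cD; rewrite addr0.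
rewrite (_ : (fun n => _) = psum (fun k => conjc (fcoef s (cutoff c d P) k) * fcoef s g k))//.
apply/funext => N; rewrite !psumE -big_split/=; apply: eq_bigr => k _.
by rewrite gu /Scoef [RHS]mulrDr.
Qed.

End orthogonality.

(** * Lebesgue points *)

Section lebesgue_points.
Context {R : realType}.
Local Notation mu := (@lebesgue_measure R).
Local Notation I := (@I01 R).
Variables (h : R -> R) (m : nat).
Hypothesis ih : mu.-integrable I (EFin \o h).

Let n := (2 * m).+4.
Let phi c d y : R := (test_poly c d m).[clamp c d y].

Let mI : measurable I. Proof. exact: measurable_I01. Qed.

Lemma test_poly_horner (c d y : R) : (test_poly c d m).[y] = ((y - c) * (y - d)) ^+ n.
Proof. by rewrite /test_poly horner_exp hornerM !hornerE. Qed.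

(** As h is orthogonal to the bump, h(x) times the integral of the bump equals the integral of (h(x)
    - h) against it. The former is bounded below on the middle half, an interval of length r, and
    the latter above by the maximum r^(2n); that power cancels. *)
Lemma test_average_le (x r : R) : 0 < r -> 0 < x - r -> x + r < 1 ->
  Rintegral mu I (fun y => h y * phi (x - r) (x + r) y) = 0 ->
  mu.-integrable (ball x r) (EFin \o (fun y => `|h y - h x|)) /\
  `|h x| * (3 / 4) ^+ n * r <= Rintegral mu (ball x r) (fun y => `|h y - h x|).
Proof.
move=> r0 xr0 xr1 hphi0.
set c := x - r; set d := x + r.
have cd : c < d by rewrite /c /d; lra.
have ballE : ball x r = `]c, d[%classic by rewrite ball_itv.
have mB : measurable (ball x r) by exact: measurable_ball.
have BI : ball x r `<=` I.
  rewrite ballE /I01 => y /=; rewrite !in_itv/= => /andP[cy yd].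
  by apply/andP; split; rewrite /c /d in cy yd; lra.
have neven : ~~ odd n by rewrite /n /= oddM.
have phi_ge0 y : 0 <= phi c d y.
  by rewrite /phi test_poly_horner exprn_even_ge0.
have nE : n = (2 * m.+2)%N by rewrite /n; lia.
(* The product (y - c)(y - d) is the opposite of this base; the even exponent removes the sign. *)
have phi_in y : ball x r y -> phi c d y = (r ^+ 2 - (y - x) ^+ 2) ^+ n.
  rewrite ballE /= in_itv/= => /andP[cy yd].
  rewrite /phi clamp_in ?(ltW cy) ?(ltW yd)// test_poly_horner.
  by rewrite nE !exprM; congr (_ ^+ _); rewrite /c /d; ring.
have phi_out y : ~ ball x r y -> phi c d y = 0.
  rewrite ballE /= in_itv/= => /negP ycd.
  have [Pc Pd] := @test_poly_root R c d m 0 isT.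
  by have [] := cutoff_out cd Pc Pd ycd.
pose A := (r ^+ 2) ^+ n.
have A0 : 0 < A by rewrite !exprn_gt0.
have phi_le y : ball x r y -> phi c d y <= A.
  move=> By; rewrite phi_in// lerXn2r ?nnegrE ?sqr_ge0//.
    move: By; rewrite ballE /= in_itv/= /c /d => /andP[? ?].
    have -> : r ^+ 2 - (y - x) ^+ 2 = (r - (y - x)) * (r + (y - x)) by ring.
    by rewrite mulr_ge0//; lra.
  by rewrite gerBl sqr_ge0.
pose HB : set R := `[x - r / 2, x + r / 2]%classic.
have HBB : HB `<=` ball x r.
  rewrite ballE /HB => y /=; rewrite !in_itv/= /c /d => /andP[? ?].
  by apply/andP; split; lra.
(* Within r / 2 of the centre, r^2 - (y - x)^2 is at least r^2 - r^2 / 4. *)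
have phi_ge y : HB y -> (3 / 4) ^+ n * A <= phi c d y.
  move=> Hy; rewrite phi_in; last exact: HBB.
  move: Hy; rewrite /HB /= in_itv/= => /andP[? ?].
  rewrite /A -exprMn lerXn2r ?nnegrE//.
  - by rewrite mulr_ge0 ?sqr_ge0//; lra.
  - have -> : r ^+ 2 - (y - x) ^+ 2 = (r - (y - x)) * (r + (y - x)) by ring.
    by rewrite mulr_ge0//; lra.
  - have : 0 <= (r / 2 - (y - x)) * (r / 2 + (y - x)) by rewrite mulr_ge0//; lra.
    by nra.
have c0 : 0 < c by [].
have d1 : d < 1 by [].
have [B _ hB] := cutoff_bounded c0 cd d1 (test_poly c d m).
have mcut := @cmeas_cutoff R c d (test_poly c d m).
have iphi : mu.-integrable I (EFin \o phi c d).
  by have [] := @cintegrable_bounded R _ B mcut (fun y _ => hB y).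
have ihC : cintegrable (fun y => (h y)%:C).
  by split => //=; exact: integrable_cst_I01.
have ihphi : mu.-integrable I (EFin \o (fun y => h y * phi c d y)).
  have [+ _] := cintegrableMb ihC mcut (fun y _ => hB y).
  rewrite (_ : (fun y => complex.Re _) = fun y => h y * phi c d y)//.
  by apply/funext => y; rewrite /= mul0r subr0.
have ihxphi : mu.-integrable I (EFin \o (fun y => h x * phi c d y)).
  exact: integrableZ_real.
have iB : mu.-integrable (ball x r) (EFin \o (fun y => `|h y - h x|)).
  apply: integrable_norm.
  have : mu.-integrable I ((EFin \o h) \- (EFin \o cst (h x)))%E.
    by apply: integrableB => //; exact: integrable_cst_I01.
  by apply: integrableS.
have WE : h x * Rintegral mu I (phi c d) = Rintegral mu I (fun y => (h x - h y) * phi c d y).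
  under [RHS]eq_Rintegral do rewrite mulrBl.
  by rewrite RintegralB// hphi0 subr0 RintegralZl.
have idiff : mu.-integrable I (EFin \o (fun y => (h x - h y) * phi c d y)).
  by apply: eq_integrable (integrableB _ ihxphi ihphi) => // y _ /=; rewrite mulrBl.
pose k y := (fun y => `|h y - h x|) \_ (ball x r) y.
have ik : mu.-integrable I (EFin \o k).
  rewrite /k -restrict_EFin; apply/integrable_restrict => //.
  by rewrite setIC (setIidl BI).
have up : `|h x| * Rintegral mu I (phi c d) <= A * Rintegral mu (ball x r) (fun y => `|h y - h x|).
  have -> : Rintegral mu (ball x r) (fun y => `|h y - h x|) = Rintegral mu I k.
    by rewrite -Rintegral_mkcondr setIC (setIidl BI).
  rewrite -RintegralZl//.
  rewrite -[X in _ * X <= _]ger0_norm; last by apply: Rintegral_ge0 => y _; exact: phi_ge0.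
  rewrite -normrM WE (le_trans (le_normr_Rintegral _ idiff))//.
  apply: le_Rintegral => //.
  - exact: integrable_norm.
  - exact: integrableZ_real.
  - move=> y Iy; rewrite normrM (ger0_norm (phi_ge0 _)) /k patchE.
    case: ifPn => [|] yB.
      by rewrite mulrC distrC ler_wpM2r//; apply: phi_le; rewrite inE in yB.
    by rewrite phi_out ?mulr0//; rewrite notin_setE in yB.
have low : (3 / 4) ^+ n * A * r <= Rintegral mu I (phi c d).
  pose w y := (cst ((3 / 4) ^+ n * A) : R -> R) \_ HB y.
  have mHB : measurable HB by exact: measurable_itv.
  have HBI : HB `<=` I by apply: subset_trans BI.
  have muHB : fine (mu HB) = r.
    rewrite /HB lebesgue_measure_itv/= lte_fin ifT; last lra.
    by rewrite -EFinB /=; field.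
  have -> : (3 / 4) ^+ n * A * r = Rintegral mu I w.
    by rewrite -Rintegral_mkcondr setIC (setIidl HBI) Rintegral_cst// muHB.
  apply: le_Rintegral => //.
    rewrite /w -restrict_EFin; apply/integrable_restrict => //.
    by apply: integrableS (integrable_cst_I01 _) => //; exact: measurableI.
  move=> y Iy; rewrite /w patchE; case: ifPn => yHB; last exact: phi_ge0.
  by apply: phi_ge; rewrite inE in yHB.
split=> //; have := le_trans (ler_wpM2l (normr_ge0 (h x)) low) up.
rewrite (_ : `|h x| * ((3 / 4) ^+ n * A * r) = A * (`|h x| * (3 / 4) ^+ n * r)); last by ring.
by rewrite ler_pM2l.
Qed.

Lemma ae_eq0_of_test (a b : R) : 0 <= a -> b <= 1 ->
  (forall c d, a < c -> c < d -> d < b ->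
    Rintegral mu I (fun y => h y * phi c d y) = 0) ->
  {ae mu, forall x, a < x < b -> h x = 0}.
Proof.
move=> a0 b1 test0.
(* Extension by zero makes the function locally integrable on the whole line, as Lebesgue
   differentiation is applied there; on the unit interval nothing changes. *)
pose H := h \_ I.
have locH : locally_integrable setT H.
  apply: open_integrable_locally; first exact: openT.
  by rewrite /H -restrict_EFin; apply/integrable_restrict => //; rewrite setTI.
apply: (filterS (Filter := ae_filter_ringOfSetsType mu)) (lebesgue_differentiation locH).
move=> x Lx /andP[ax xb].
have HE y : I y -> H y = h y by move=> Iy; rewrite /H patchE mem_set.
have Ix : I x by rewrite /I01 /= in_itv/=; apply/andP; split; lra.
(* On small balls the mean oscillation is at least this constant, the 1/2 being r over the length
   2r, whereas at a Lebesgue point it tends to 0. *)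
suff : ((`|h x| * (3 / 4) ^+ n / 2)%:E <= 0%:E)%E.
  rewrite lee_fin => le0; apply/eqP; rewrite -normr_le0.
  have q0 : (0 : R) < (3 / 4) ^+ n by apply: exprn_gt0; lra.
  by rewrite -(pmulr_lle0 _ q0) -(@pmulr_lle0 _ 2^-1) ?invr_gt0// mulrC.
apply: cvge_ge Lx.
near=> r.
have r0 : 0 < r by [].
have ra : r < x - a by near: r; apply: nbhs_right_lt; lra.
have rb : r < b - x by near: r; apply: nbhs_right_lt; lra.
have xr0 : 0 < x - r by lra.
have xr1 : x + r < 1 by lra.
have hphi0 : Rintegral mu I (fun y => h y * phi (x - r) (x + r) y) = 0.
  by apply: test0; lra.
have [iB le] := test_average_le r0 xr0 xr1 hphi0.
rewrite /davg /iavg lebesgue_measure_ball ?(ltW r0)//.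
have -> : (\int[mu]_(y in ball x r) `|((center (H x) \o H) y)%:E| =
    (Rintegral mu (ball x r) (fun y => `|h y - h x|))%:E)%E.
  rewrite /Rintegral fineK; last by apply: integrable_fin_num iB; exact: measurable_ball.
  apply: eq_integral => y; rewrite inE => yB /=.
  have Iy : I y.
    move: yB; rewrite ball_itv /I01 /= !in_itv/= => /andP[? ?].
    by apply/andP; split; lra.
  by rewrite !HE.
rewrite inver mulrn_eq0/= gt_eqF//= -EFinM lee_fin.
have -> : (r *+ 2)^-1 = r^-1 / 2 by rewrite -(mulr_natr r 2) invfM.
by rewrite [leRHS]mulrAC ler_wpM2r ?invr_ge0// [leRHS]mulrC ler_pdivlMr.
Unshelve. all: by end_near. Qed.

End lebesgue_points.

(** * Locality of the periodic and antiperiodic operators *)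

Theorem theorem3 (R : realType) (m : nat) (V : int -> R[i]) (s : pm)
  (u : int -> R[i]) (f g : R -> R[i]) (a b : R) :
  (0 < m)%N ->
  inH pl (- (m%:Z)) V ->
  (* u in Dom(S_s(V)) *)
  inH s m%:Z u -> inH s 0 (Scoef s m V u) ->
  (* f is u as an element of L_2(0,1), g is S_s(V) u *)
  represents s f u -> represents s g (Scoef s m V u) ->
  0 <= a -> a < b -> b <= 1 ->
  (\forall x \ae (@lebesgue_measure R), a < x < b -> f x = 0) ->
  (\forall x \ae (@lebesgue_measure R), a < x < b -> g x = 0).
Proof.
move=> _ hV hu _ hf hg a0 _ b1 f0.
have [intRe intIm] : cintegrable g by apply: inL2_cintegrable; case: hg.
have test0 c d : a < c -> c < d -> d < b ->
    Cint (fun x => g x * cutoff c d (test_poly c d m) x) = 0.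
  by move=> ac cd db; exact: (Cint_test_eq0 hV hu hf hg a0 b1 ac cd db f0).
(* The bump is real, so the complex orthogonality splits, and the argument at Lebesgue points
   applies to the real and imaginary parts of g. *)
have gRe := @ae_eq0_of_test R _ m intRe a b a0 b1.
have gIm := @ae_eq0_of_test R _ m intIm a b a0 b1.
have aeF := ae_filter_ringOfSetsType (@lebesgue_measure R).
apply: (@filterS2 _ _ aeF _ _ _ _ (gRe _) (gIm _)) => [x Re0 Im0 xab|c d ac cd db|c d ac cd db].
- by apply: complex_eqP; [exact: Re0|exact: Im0].
- rewrite -[RHS](congr1 (@complex.Re R) (test0 c d ac cd db)) /=.
  by apply: eq_Rintegral => y _; rewrite Re_mulc mulr0 subr0.
- rewrite -[RHS](congr1 (@complex.Im R) (test0 c d ac cd db)) /=.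
  by apply: eq_Rintegral => y _; rewrite Im_mulc mulr0 add0r.
Qed.
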